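(* Let $\mathfrak J_{\mathbb Z}$ be one of $\mathbb Z\oplus\mathbb Z\oplus\mathbb Z$, $\mathcal H_3(\mathbb B_{\mathbb Z})$, $\mathcal H_3(\mathbb H_{\mathbb Z})$, $\mathcal H_3(\mathbb O_{\mathbb Z})$, let $\mathfrak M_{\mathbb Z}=\mathfrak M(\mathfrak J_{\mathbb Z})$, let $x\in\mathfrak M_{\mathbb Z}$, and let $q'$ be the quartic invariant of $\mathfrak M_{\mathbb Z}$. Then $\gcd T(x,x,x)=\gcd\frac12\nabla q'(x)$, and hence: - if $\gcd\frac12\nabla q'(x)=1$, then $x$ is projective; - if $\gcd\frac12\nabla q'(x)\ge3$ or $\nabla q'(x)=0$, then $x$ is not projective.
   Context: Composition rings. $\mathbb H_{\mathbb Z}=M_2(\mathbb Z)$ with norm $\mathbf n=\det$, and conjugation $\overline{\begin{pmatrix}a&b\\c&d\end{pmatrix}}=\begin{pmatrix}d&-b\\-c&a\end{pmatrix}$; $\mathbb B_{\mathbb Z}\subset\mathbb H_{\mathbb Z}$ is the subring of diagonal matrices; $\mathbb O_{\mathbb Z}=\mathbb H_{\mathbb Z}\oplus\mathbb H_{\mathbb Z}v$ with product $(a+bv)(c+dv)=(ac-\bar d b)+(da+b\bar c)v$, norm $\mathbf n(a+bv)=\det a+\det b$, conjugation $\overline{a+bv}=\bar a-bv$. Put $\mathbf n(u,w)=\mathbf n(u+w)-\mathbf n(u)-\mathbf n(w)$. $\mathcal H_3(C_{\mathbb Z})$ is the $\mathbb Z$-module of Hermitian matrices $A=\begin{pmatrix}a&z&\bar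 y\\ \bar z&b&x\\ y&\bar x&c\end{pmatrix}$, $a,b,c\in\mathbb Z$, $x,y,z\in C_{\mathbb Z}$, with cubic norm $N(A)=abc-a\,x\bar x-b\,y\bar y-c\,z\bar z+(xy)z+\bar z(\bar y\bar x)$ and trace bilinear form $(A,A')=aa'+bb'+cc'+\mathbf n(x,x')+\mathbf n(y,y')+\mathbf n(z,z')$; the element with $x=y=z=0$ is written $\mathrm{diag}\{a,b,c\}$. For $\mathfrak J_{\mathbb Z}=\mathbb Z\oplus\mathbb Z\oplus\mathbb Z$, $N(a_1,a_2,a_3)=a_1a_2a_3$ and $(a,b)=\sum a_ib_i$. In all cases the sharp map is defined by $(A^\#,B)=3N(A,A,B)$ for all $B$, where $N(\cdot,\cdot,\cdot)$ is the symmetric trilinear form (over $\mathbb Q$) with $N(A,A,A)=N(A)$. $\mathfrak M_{\mathbb Z}=\mathbb Z\oplus\mathbb Z\oplus\mathfrak J_{\mathbb Z}\oplus\mathfrak J_{\mathbb Z}$, with elements $x=(\alpha,\beta,A,B)$. For $y=(\gamma,\delta,C,D)$, $\{x,y\}=\alpha\delta-\beta\gamma+(A,D)-(B,C)$; $q(x)=8(A^\#,B^\#)-8\alpha N(A)-8\beta N(B)-2\bigl((A,B)-\alpha\beta\bigr)^2$, and $q'=-\tfrac12q$. $\mathrm{Inv}(\mathfrak M_{\mathbb Z})$ is the group of invertible $\mathbb Z$-linear transformations of $\mathfrak M_{\mathbb Z}$ preserving $q$ and $\{\cdot,\cdot\}$. With $q(x,y,z,w)$ the symmetric four-linear form over $\mathbb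 Q$ satisfying $q(x,x,x,x)=q(x)$, $T(x,x,x)$ is defined by $\{T(x,x,x),w\}=q(x,x,x,w)$ for all $w$; it lies in $\mathfrak M_{\mathbb Z}$. For a nonzero element $m$ of a free $\mathbb Z$-module, $\gcd(m)$ is the greatest integer $d$ such that $m=dm'$ with $m'$ in the module. $\nabla q'(x)$ is the vector of partial derivatives of $q'$, viewed as a polynomial in the natural integral coordinates of $\mathfrak M_{\mathbb Z}$ ($\alpha,\beta$, and for each of $A,B$ the diagonal entries and the matrix-entry coordinates of $x,y,z\in C_{\mathbb Z}$; altogether $8,20,32,56$ coordinates respectively); all these partial derivatives have even coefficients. Projective elements. (a) For $\mathfrak J_{\mathbb Z}=\mathbb Z\oplus\mathbb Z\oplus\mathbb Z$, an element $x=(\alpha,\beta,(a_1,a_2,a_3),(b_1,b_2,b_3))$ is projective if each of the three binary quadratic forms in $X,Y$ $$(\alpha a_i-b_jb_k)X^2+(-a_ib_i+a_jb_j+a_kb_k-\alpha\beta)XY+(\beta b_i-a_ja_k)Y^2,\quad \{i,j,k\}=\{1,2,3\},\ i=1,2,3,$$ is primitive, i.e. the gcd of its coefficients is $1$. (b) For $\mathfrak J_{\mathbb Z}=\mathcal H_3(C_{\mathbb Z})$, $x\in\mathfrak M_{\mathbb Z}$ is projective if its $\mathrm{Inv}(\mathfrak M_{\mathbb Z})$-orbit contains an element $(\alpha,\beta,\mathrm{diag}\{a_1,a_2,a_3\},0)$ with $\alpha>0$, $\alpha\mid\beta$, $\alpha\mid a_i$ for all $i$, for which $(\alpha,\beta,(a_1,a_2,a_3),0)$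 is projective in the sense of (a). *)

(* Defs.v *)
From mathcomp Require Import all_boot all_order all_algebra.
From mathcomp Require Import ring.
From mathcomp Require Import mpoly.

Set Implicit Arguments.
Unset Strict Implicit.
Unset Printing Implicit Defensive.

Import Order.TTheory GRing.Theory Num.Theory.
Local Open Scope ring_scope.

(* Everything is written in coordinates over an arbitrary commutative ring K:
   K = int gives the lattices, K = rat their rational spans, and
   K = {mpoly rat[n]} lets the invariants be evaluated at the generic point,
   i.e. viewed as polynomials in the integral coordinates. *)

(* The iterated finite difference of f at 0 along h_1, ..., h_k, divided by k!.
   When f is the diagonal of a symmetric k-linear form, this is that form:
   see polar3 and polar4. *)
Definition polar (K : comUnitRingType) (V : zmodType) (f : V -> K)
    (hs : seq V) : K :=
  foldr (fun h (g : V -> K) v => g (v + h) - g v) f hs 0 / (size hs)`!%:R.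

(* The u such that b u w = l w for all w, for b bilinear with invertible Gram
   matrix and l linear: see dualizeP. Both forms used below have a signed
   permutation matrix as Gram matrix. *)
Definition dualize (K : comUnitRingType) (n : nat)
    (b : 'rV[K]_n -> 'rV[K]_n -> K) (l : 'rV[K]_n -> K) : 'rV[K]_n :=
  (\row_j l (delta_mx 0 j))
    *m invmx (\matrix_(i, j) b (delta_mx 0 i) (delta_mx 0 j)).

Definition mx2 (K : nzRingType) (a b c d : K) : 'M[K]_2 :=
  \matrix_(i, j) if i == 0 then (if j == 0 then a else b)
                 else (if j == 0 then c else d).

Definition hconj (K : nzRingType) (A : 'M[K]_2) : 'M[K]_2 :=
  mx2 (A 1 1) (- A 0 1) (- A 1 0) (A 0 0).

(* (a, b) stands for a + b v *)
Definition oct (K : nzRingType) := ('M[K]_2 * 'M[K]_2)%type.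

Definition omul (K : nzRingType) (x y : oct K) : oct K :=
  let: (a, b) := x in let: (c, d) := y in
  (a *m c - hconj d *m b, d *m a + b *m hconj c).

Definition oconj (K : nzRingType) (x : oct K) : oct K :=
  (hconj x.1, - x.2).

Definition onorm (K : comNzRingType) (x : oct K) : K := \det x.1 + \det x.2.

Definition onorm2 (K : comNzRingType) (x y : oct K) : K :=
  onorm (x + y) - onorm x - onorm y.

(* Reads off s from the octonion s 1; it is only applied to elements of that
   form, by omul_conj and oadd_conj below. *)
Definition oscal (K : nzRingType) (x : oct K) : K := x.1 0 0.

Inductive composition := CompB | CompH | CompO.

Definition cdim (C : composition) : nat :=
  match C with CompB => 2 | CompH => 2 * 2 | CompO => 2 * 2 + 2 * 2 end.

(* The element with the given matrix-entry coordinates. As B and H are subrings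
   of O with the induced norm and conjugation, no operation of their own is
   needed. *)
Definition celt (K : nzRingType) (C : composition) : 'rV[K]_(cdim C) -> oct K :=
  match C return 'rV[K]_(cdim C) -> oct K with
  | CompB => fun u => (diag_mx u, 0)
  | CompH => fun u => (vec_mx u, 0)
  | CompO => fun u => (vec_mx (lsubmx u), vec_mx (rsubmx u))
  end.

Inductive jordan := Split | Herm of composition.

Definition jdim (J : jordan) : nat :=
  match J with
  | Split => 3
  | Herm C => 3 + (cdim C + (cdim C + cdim C))
  end.

Section Herm.
Variables (K : comNzRingType) (C : composition).
Implicit Type A : 'rV[K]_(jdim (Herm C)).

Definition hdiag A : 'rV[K]_3 := lsubmx A.
Definition hx A : oct K := celt (lsubmx (rsubmx A)).
Definition hy A : oct K := celt (lsubmx (rsubmx (rsubmx A))).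
Definition hz A : oct K := celt (rsubmx (rsubmx (rsubmx A))).

Definition hnorm A : K :=
  let a := hdiag A 0 0 in let b := hdiag A 0 1 in let c := hdiag A 0 2%:R in
  let x := hx A in let y := hy A in let z := hz A in
  a * b * c - a * oscal (omul x (oconj x)) - b * oscal (omul y (oconj y))
    - c * oscal (omul z (oconj z))
    + oscal (omul (omul x y) z + omul (oconj z) (omul (oconj y) (oconj x))).

Definition htr A A' : K :=
  \sum_i hdiag A 0 i * hdiag A' 0 i
    + onorm2 (hx A) (hx A') + onorm2 (hy A) (hy A') + onorm2 (hz A) (hz A').

End Herm.

Definition jnorm (K : comNzRingType) (J : jordan) : 'rV[K]_(jdim J) -> K :=
  match J return 'rV[K]_(jdim J) -> K with
  | Split => fun a => a 0 0 * a 0 1 * a 0 2%:R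
  | Herm C => @hnorm K C
  end.

Definition jtr (K : comNzRingType) (J : jordan) :
    'rV[K]_(jdim J) -> 'rV[K]_(jdim J) -> K :=
  match J return 'rV[K]_(jdim J) -> 'rV[K]_(jdim J) -> K with
  | Split => fun a b => \sum_i a 0 i * b 0 i
  | Herm C => @htr K C
  end.

Definition jnorm3 (K : comUnitRingType) (J : jordan)
    (A B C : 'rV[K]_(jdim J)) : K :=
  polar (@jnorm K J) [:: A; B; C].

Definition sharp (K : comUnitRingType) (J : jordan)
    (A : 'rV[K]_(jdim J)) : 'rV[K]_(jdim J) :=
  dualize (@jtr K J) (fun B => 3%:R * jnorm3 A A B).

Definition mdim (J : jordan) : nat := 1 + (1 + (jdim J + jdim J)).

Definition melt (K : nzRingType) (J : jordan) (al be : K)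
    (A B : 'rV[K]_(jdim J)) : 'rV[K]_(mdim J) :=
  row_mx al%:M (row_mx be%:M (row_mx A B)).

Section Components.
Variables (K : nzRingType) (J : jordan) (x : 'rV[K]_(mdim J)).
Definition malpha : K := lsubmx x 0 0.
Definition mbeta : K := lsubmx (rsubmx x) 0 0.
Definition mA : 'rV[K]_(jdim J) := lsubmx (rsubmx (rsubmx x)).
Definition mB : 'rV[K]_(jdim J) := rsubmx (rsubmx (rsubmx x)).
End Components.

Definition symp (K : comNzRingType) (J : jordan) (x y : 'rV[K]_(mdim J)) : K :=
  malpha x * mbeta y - mbeta x * malpha y
    + jtr (mA x) (mB y) - jtr (mB x) (mA y).

Definition quartic (K : comUnitRingType) (J : jordan)
    (x : 'rV[K]_(mdim J)) : K :=
  8%:R * jtr (sharp (mA x)) (sharp (mB x))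
    - 8%:R * malpha x * jnorm (mA x) - 8%:R * mbeta x * jnorm (mB x)
    - 2%:R * (jtr (mA x) (mB x) - malpha x * mbeta x) ^+ 2.

Definition quartic' (K : comUnitRingType) (J : jordan)
    (x : 'rV[K]_(mdim J)) : K :=
  - (2%:R^-1 * quartic x).

Definition quartic4 (K : comUnitRingType) (J : jordan)
    (x y z w : 'rV[K]_(mdim J)) : K :=
  polar (@quartic K J) [:: x; y; z; w].

(* T(x, x, x) *)
Definition Tcube (K : comUnitRingType) (J : jordan)
    (x : 'rV[K]_(mdim J)) : 'rV[K]_(mdim J) :=
  dualize (@symp K J) (quartic4 x x x).

Definition quartic'_poly (J : jordan) : {mpoly rat[mdim J]} :=
  quartic' (\row_i 'X_i : 'rV[{mpoly rat[mdim J]}]_(mdim J)).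

Definition grad (J : jordan) (x : 'rV[rat]_(mdim J)) : 'rV[rat]_(mdim J) :=
  \row_i (mderiv i (quartic'_poly J)).@[fun j => x 0 j].

Definition ratv (n : nat) (x : 'rV[int]_n) : 'rV[rat]_n := map_mx intr x.

(* The greatest d such that m = d m' with m' integral, for m a nonzero integral
   vector: see vgcdP. Such a d is at most the sum of the |m_j|, whence the range
   of the maximum. By convention the gcd of 0 is 0. *)
Definition vgcd (n : nat) (m : 'rV[rat]_n) : nat :=
  \max_(d < (\sum_j `|numq (m 0%R j)|)%N.+1
         | [forall j, m 0 j / d%:R \is a Num.int]) d.

Definition in_Inv (J : jordan) (g : 'M[int]_(mdim J)) : Prop :=
  [/\ g \in unitmx,
      forall x : 'rV[int]_(mdim J),
        quartic (ratv (x *m g)) = quartic (ratv x)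
    & forall x y : 'rV[int]_(mdim J), symp (x *m g) (y *m g) = symp x y].

Definition primitive_form (a b c : int) : Prop := gcdz (gcdz a b) c = 1.

Definition split_projective (al be : int) (a b : 'rV[int]_3) : Prop :=
  forall i j k : 'I_3, i != j -> i != k -> j != k ->
    primitive_form
      (al * a 0 i - b 0 j * b 0 k)
      (- (a 0 i * b 0 i) + a 0 j * b 0 j + a 0 k * b 0 k - al * be)
      (be * b 0 i - a 0 j * a 0 k).

Definition herm_diag (C : composition) (a : 'rV[int]_3) :
    'rV[int]_(jdim (Herm C)) :=
  row_mx a 0.

Definition projective (J : jordan) : 'rV[int]_(mdim J) -> Prop :=
  match J return 'rV[int]_(mdim J) -> Prop with
  | Split => fun x : 'rV[int]_(mdim Split) =>
      split_projective (malpha x) (mbeta x) (mA x) (mB x)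
  | Herm C => fun x : 'rV[int]_(mdim (Herm C)) =>
      exists (g : 'M[int]_(mdim (Herm C))) (al be : int) (a : 'rV[int]_3),
        [/\ in_Inv g, x *m g = melt al be (herm_diag C a) 0,
            [/\ 0 < al, (al %| be)%Z & forall i, (al %| a 0%R i)%Z]
          & split_projective al be a 0]
  end.

Lemma polar3 (K : comUnitRingType) (V : zmodType) (F : V -> V -> V -> K) :
    3`!%:R \is a @GRing.unit K ->
    (forall x x' y z, F (x + x') y z = F x y z + F x' y z) ->
    (forall x y z, F x y z = F y x z) -> (forall x y z, F x y z = F x z y) ->
  forall x y z, polar (fun v => F v v v) [:: x; y; z] = F x y z.
Proof.
move=> u6 F1 s12 s23 x y z.
have F2 a b b' c : F a (b + b') c = F a b c + F a b' c.
  by rewrite s12 F1 !(s12 _ a).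
have F3 a b c c' : F a b (c + c') = F a b c + F a b c'.
  by rewrite s23 F2 !(s23 a _ b).
rewrite /polar /= !add0r; apply: (canLR (mulrK u6)).
rewrite !(F1, F2, F3).
have F0 b c : F 0 b c = 0 by apply: (addrI (F 0 b c)); rewrite -F1 !addr0.
rewrite !F0 (s23 x z y) (s12 y x z) (s23 y z x) (s12 y x z).
rewrite (s12 z x y) (s23 x z y) (s23 z y x) (s12 z x y) (s23 x z y).
have -> : 3`!%:R = 6%:R :> K by [].
ring.
Qed.

Lemma polar4 (K : comUnitRingType) (V : zmodType) (F : V -> V -> V -> V -> K) :
    4`!%:R \is a @GRing.unit K ->
    (forall x x' y z w, F (x + x') y z w = F x y z w + F x' y z w) ->
    (forall x y z w, F x y z w = F y x z w) ->
    (forall x y z w, F x y z w = F x z y w) ->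
    (forall x y z w, F x y z w = F x y w z) ->
  forall x y z w, polar (fun v => F v v v v) [:: x; y; z; w] = F x y z w.
Proof.
move=> u24 F1 s12 s23 s34 x y z w.
have F2 a b b' c d : F a (b + b') c d = F a b c d + F a b' c d.
  by rewrite s12 F1 !(s12 _ a).
have F3 a b c c' d : F a b (c + c') d = F a b c d + F a b c' d.
  by rewrite s23 F2 !(s23 a _ b).
have F4 a b c d d' : F a b c (d + d') = F a b c d + F a b c d'.
  by rewrite s34 F3 !(s34 a b _ c).
have F0 b c d : F 0 b c d = 0 by apply: (addrI (F 0 b c d)); rewrite -F1 !addr0.
rewrite /polar /= !add0r F0 subr0; apply: (canLR (mulrK u24)).
have -> : 4`!%:R = 24%:R :> K by [].
transitivity (
 (F x y z w + F x y w z + F x z y w + F x z w y + F x w y z + F x w z y) +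
 (F y x z w + F y x w z + F y z x w + F y z w x + F y w x z + F y w z x) +
 (F z y x w + F z y w x + F z x y w + F z x w y + F z w y x + F z w x y) +
 (F w y z x + F w y x z + F w z y x + F w z x y + F w x y z + F w x z y)).
  rewrite !(F1, F2, F3, F4); ring.
have p a b c d :
    F a b c d + F a b d c + F a c b d + F a c d b + F a d b c + F a d c b
      = F a b c d *+ 6.
  have e1 : F a b d c = F a b c d by [].
  have e2 : F a c b d = F a b c d by [].
  have e3 : F a c d b = F a b c d by rewrite s34 s23.
  have e4 : F a d b c = F a b c d by rewrite s23 s34.
  have e5 : F a d c b = F a b c d by rewrite s34 s23 s34.
  by rewrite e1 e2 e3 e4 e5 !mulrS mulr0n !addrA addr0.
have e1 : F y x z w = F x y z w by [].
have e2 : F z y x w = F x y z w by rewrite s12 s23 s12.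
have e3 : F w y z x = F x y z w by rewrite s12 s23 s34 s23 s12.
rewrite !p e1 e2 e3; ring.
Qed.

Lemma dualizeP (K : comUnitRingType) (n : nat)
    (b : 'rV[K]_n -> 'rV[K]_n -> K) (l : 'rV[K]_n -> K) :
    (forall w, scalar (b^~ w)) -> (forall u, scalar (b u)) -> scalar l ->
    (\matrix_(i, j) b (delta_mx 0 i) (delta_mx 0 j)) \in unitmx ->
  forall u, (forall w, b u w = l w) <-> u = dualize b l.
Proof.
move=> bl br ll uG u; set G := \matrix_(i, j) _ in uG *.
have lin (f : 'rV[K]_n -> K) (w : 'rV[K]_n) : scalar f ->
    f w = \sum_j w 0 j * f (delta_mx 0 j).
  move=> fl; have f0 : f 0 = 0.
    by have := fl (-1) 0 0; rewrite scaleN1r oppr0 add0r mulN1r addNr.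
  rewrite {1}(row_sum_delta w).
  elim/big_rec2: _ => [|j a v _ <-] //; exact: fl.
have E w : b w =1 l <-> w *m G = \row_j l (delta_mx 0 j).
  have c j : (w *m G) 0 j = b w (delta_mx 0 j).
    by rewrite (lin (b^~ _) w (bl _)) mxE; apply: eq_bigr => i _; rewrite mxE.
  split=> [e | e v]; first by apply/rowP => j; rewrite c e mxE.
  rewrite (lin _ v (br w)) (lin _ v ll); apply: eq_bigr => j _.
  by rewrite -c e mxE.
rewrite (E u : (forall w, b u w = l w) <-> _) /dualize -/G.
by split=> [<- | ->]; rewrite ?mulmxK ?mulmxKV.
Qed.

Lemma mx2P (K : nzRingType) (A B : 'M[K]_2) :
  A 0 0 = B 0 0 -> A 0 1 = B 0 1 -> A 1 0 = B 1 0 -> A 1 1 = B 1 1 -> A = B.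
Proof.
move=> e00 e01 e10 e11; apply/matrixP=> i j.
have c (k : 'I_2) : k = 0 \/ k = 1.
  by case: k => [[|[|k]] lk]; [left | right |]; try exact: val_inj.
by case: (c i) => ->; case: (c j) => ->.
Qed.

Lemma det2 (K : comNzRingType) (A : 'M[K]_2) :
  \det A = A 0 0 * A 1 1 - A 0 1 * A 1 0.
Proof.
rewrite (expand_det_row _ 0) !big_ord_recl big_ord0 addr0 /cofactor !det_mx11.
rewrite !mxE /=; have -> : lift (0 : 'I_2) (0 : 'I_1) = 1 by exact: val_inj.
have -> : lift (1 : 'I_2) (0 : 'I_1) = 0 by exact: val_inj.
by rewrite expr0 expr1; ring.
Qed.

Lemma mul2 (K : nzRingType) (A B : 'M[K]_2) i j :
  (A *m B) i j = A i 0 * B 0 j + A i 1 * B 1 j.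
Proof.
rewrite mxE !big_ord_recl big_ord0 addr0.
by have -> : lift (0 : 'I_2) (0 : 'I_1) = 1 by exact: val_inj.
Qed.

Lemma omul_conj (K : comNzRingType) (x : oct K) :
  omul x (oconj x) = ((onorm x)%:M, 0).
Proof.
case: x => a b; rewrite /omul /oconj /onorm /=.
by congr pair; apply: mx2P; rewrite ?det2 !(mul2, mxE) /= ?mulr1n ?mulr0n; ring.
Qed.

Lemma oadd_conj (K : comNzRingType) (x : oct K) :
  x + oconj x = ((oscal (x + oconj x))%:M, 0).
Proof.
case: x => a b; rewrite /oconj /oscal /=; congr pair; last exact: subrr.
by apply: mx2P; rewrite !mxE /= ?mulr1n ?mulr0n; ring.
Qed.

Lemma oconj_mul (K : comNzRingType) (x y : oct K) :
  oconj (omul x y) = omul (oconj y) (oconj x).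
Proof.
case: x y => [a b] [c d]; rewrite /omul /oconj /=.
by congr pair; apply: mx2P; rewrite !(mul2, mxE) /=; ring.
Qed.

Lemma vgcdP (n : nat) (m : 'rV[int]_n) : m != 0 ->
  (exists m', m = (vgcd (ratv m))%:Z *: m') /\
  (forall d : int, (exists m', m = d *: m') -> d <= (vgcd (ratv m))%:Z).
Proof.
move=> m0; rewrite /vgcd; set s := (\sum_j _)%N.
set P := fun d : 'I_s.+1 => [forall j, ratv m 0 j / d%:R \is a Num.int].
have sE : s = (\sum_j `|m 0%R j|)%N.
  by apply: eq_bigr => j _; rewrite mxE numq_int.
have Hd (d : nat) (m' : 'rV[int]_n) : (0 < d)%N -> m = d%:Z *: m' ->
    (d <= s)%N /\ [forall j, ratv m 0 j / d%:R \is a Num.int].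
  move=> d0 mE; split.
    have [j mj] : exists j, m 0 j != 0.
      apply/existsP; apply: contraNT m0; rewrite negb_exists => /forallP h.
      by apply/eqP/rowP=> j; rewrite mxE; apply/eqP; rewrite -[_ == _]negbK h.
    rewrite sE (bigD1 j) //= (leq_trans _ (leq_addr _ _)) //.
    move: mj; rewrite mE mxE abszM absz_nat mulf_eq0 negb_or => /andP[_ mj].
    by rewrite leq_pmulr // absz_gt0.
  apply/forallP => j; rewrite mE !mxE intrM mulrAC mulfV ?mul1r ?intr_int //.
  by rewrite intr_eq0 -lt0n.
have [s1 P1] := Hd 1%N m isT (esym (scale1r m)).
have P1' : P (Ordinal (s1 : (1 < s.+1)%N)) by [].
have g1 : (1 <= \max_(d | P d) d)%N by exact: (leq_bigmax_cond (F := @nat_of_ord s.+1) _ P1').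
split; last first.
  move=> [d|d] [m' mE] //; case: (posnP d) => [-> //|d0].
  have [ds Pd] := Hd d m' d0 mE.
  have Pd' : P (Ordinal (ds : (d < s.+1)%N)) by [].
  by rewrite lez_nat (leq_bigmax_cond (F := @nat_of_ord s.+1) _ Pd').
have /(eq_bigmax_cond (@nat_of_ord s.+1))[d Pd dE] : (0 < #|P|)%N.
  by apply/card_gt0P; exists (Ordinal (s1 : (1 < s.+1)%N)).
have {}dE : \max_(d | P d) d = d :> nat by [].
have d0 : (0 < d)%N by rewrite -dE.
rewrite dE; exists (\row_j Num.floor (ratv m 0 j / d%:R)).
apply/rowP => j; rewrite !mxE; apply: (@intr_inj rat); rewrite intrM.
move: Pd => /forallP/(_ j); rewrite mxE => /floorK ->.
by rewrite mulrC mulfVK // pnatr_eq0 -lt0n.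
Qed.

(* Main.v *)
Require Import Defs.
From Stdlib Require Import Classical.
From mathcomp Require Import all_boot all_order all_algebra.
From mathcomp Require Import ring zify mpoly.

Set Implicit Arguments.
Unset Strict Implicit.
Unset Printing Implicit Defensive.

Import Order.TTheory GRing.Theory Num.Theory.
Local Open Scope ring_scope.

(** Everything is read off from half the differential of q', the integral form
    [qdiff x w] = 1/2 D_w q'(x), linear in w.  Over a ring in which 2 and 3 are
    invertible, [quartic] is -2 q' with q' = [qform] given by an explicit
    formula, so that q(x,x,x,w) = - [qdiff x w] ([quartic4E]) and the partial
    derivatives of q' are twice the values of [qdiff x] on the standard basis
    ([gradE]).

    The symplectic form is unimodular ([symp_gram_unit]).  Hence T(x,x,x) and
    the half gradient differ by an invertible integral matrix and have the same
    divisors ([vgcd_Tcube]).  Moreover d divides the half gradient at x exactly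
    when d divides all [qdiff x w], a condition which depends only on the orbit
    of x ([dvd_qdiff_reach]).  The rest follows from two facts.

    - For three copies of Z, q' is the discriminant P^2 - 4 A C of each of the
      three binary forms.  A common divisor of the coefficients of one form
      therefore divides [qdiff x] ([split_dvd_qdiff]), so that x is projective
      when the gcd is 1.  Conversely, for each coefficient s of the first form
      and t of the second, 2 s t is a value of [qdiff x]; if both forms are
      primitive, every divisor of [qdiff x] divides 2
      ([split_projective_dvd2]).  This excludes 0 and all d >= 3.

    - For Hermitian matrices, every nonzero x has a diagonal element
      (al, be, diag a, 0) with al > 0 dividing be and a in its orbit
      ([reach_diag]), and there [qdiff] involves only the diagonal coordinates
      ([qdiff_diag]), which reduces the assertions to the first case.

    The reduction is a Euclidean descent.  The group contains the unipotent maps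
    [phi C], and their conjugates [psi C], for every C ([inv_map_phi]).  Choose
    in the orbit an element with |al| > 0 minimal.  The moves [psi] and then
    [phi] change al by a multiple of any residue modulo al of an entry of B, so
    al divides B, which can then be cleared ([reach_clear]).  Applying [phi] to
    (al, be, A, 0) moves A, then be, into positions to which the same argument
    applies ([reach_min_dvdA], [reach_min_dvd_beta]).  Finally A is diagonalized
    by norm-preserving elementary maps, by descent on the first two diagonal
    entries ([diagonalize]).

    The three composition algebras are treated together through the product
    u * v := conj (u v).  It satisfies b(u * v, w) = b(u, v * w) and
    (u * v) * u = n(u) v = u * (v * u), and these laws imply all the identities
    used on Hermitian matrices. *)

(** * The para-product of octonions *)

Section Entries.
Variable K : comNzRingType.
Implicit Types (a b c d : K) (x y z : oct K).

Lemma mx2_eta (A : 'M[K]_2) : A = mx2 (A 0 0) (A 0 1) (A 1 0) (A 1 1).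
Proof. by apply: mx2P; rewrite !mxE. Qed.

Lemma hconj_mx2 a b c d : hconj (mx2 a b c d) = mx2 d (- b) (- c) a.
Proof. by apply: mx2P; rewrite !mxE. Qed.

Lemma mul_mx2 a b c d a' b' c' d' :
  mx2 a b c d *m mx2 a' b' c' d' =
    mx2 (a * a' + b * c') (a * b' + b * d') (c * a' + d * c') (c * b' + d * d').
Proof. by apply: mx2P; rewrite mul2 !mxE. Qed.

Lemma add_mx2 a b c d a' b' c' d' :
  mx2 a b c d + mx2 a' b' c' d' = mx2 (a + a') (b + b') (c + c') (d + d').
Proof. by apply: mx2P; rewrite !mxE. Qed.

Lemma opp_mx2 a b c d : - mx2 a b c d = mx2 (- a) (- b) (- c) (- d).
Proof. by apply: mx2P; rewrite !mxE. Qed.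

Lemma scale_mx2 k a b c d :
  k *: mx2 a b c d = mx2 (k * a) (k * b) (k * c) (k * d).
Proof. by apply: mx2P; rewrite !mxE. Qed.

Lemma det_mx2 a b c d : \det (mx2 a b c d) = a * d - b * c.
Proof. by rewrite det2 !mxE. Qed.

Lemma onorm2_mx2 a b c d e f g h a' b' c' d' e' f' g' h' :
  onorm2 (mx2 a b c d, mx2 e f g h) (mx2 a' b' c' d', mx2 e' f' g' h')
    = a * d' + d * a' - b * c' - c * b' + (e * h' + h * e' - f * g' - g * f').
Proof. by rewrite /onorm2 /onorm /= !add_mx2 !det_mx2; ring. Qed.

Lemma oct_ind (P : oct K -> Prop) :
  (forall a b c d e f g h, P (mx2 a b c d, mx2 e f g h)) -> forall x, P x.
Proof. by move=> h [a b]; rewrite (mx2_eta a) (mx2_eta b). Qed.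

(** The product of the symmetric composition algebra attached to the octonions.
    In terms of it the norm and the adjoint of a Hermitian matrix are invariant
    under the cyclic shift of (a, b, c; x, y, z). *)
Definition opara x y : oct K := oconj (omul x y).

Lemma opara_mx2 a b c d e f g h a' b' c' d' e' f' g' h' :
  opara (mx2 a b c d, mx2 e f g h) (mx2 a' b' c' d', mx2 e' f' g' h') =
  (mx2 (c * b' + d * d' - (e' * h - g' * f))
       (- (a * b' + b * d' - (h' * f - f' * h)))
       (- (c * a' + d * c' - (e' * g - g' * e)))
       (a * a' + b * c' - (h' * e - f' * g)),
   mx2 (- (e' * a + f' * c + (e * d' - f * c')))
       (- (e' * b + f' * d + (f * a' - e * b')))
       (- (g' * a + h' * c + (g * d' - h * c')))
       (- (g' * b + h' * d + (h * a' - g * b')))).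
Proof.
rewrite /opara /omul /oconj /= !hconj_mx2 !mul_mx2 !opp_mx2 !add_mx2.
rewrite !hconj_mx2 !opp_mx2.
by congr (mx2 _ _ _ _, mx2 _ _ _ _); ring.
Qed.

Lemma oscaleE k (a b : 'M[K]_2) : k *: ((a, b) : oct K) = (k *: a, k *: b).
Proof. by []. Qed.

Lemma oaddE (a b a' b' : 'M[K]_2) :
  (a, b) + (a', b') = (a + a', b + b') :> oct K.
Proof. by []. Qed.

Lemma opara_linl k x x' y : opara (k *: x + x') y = k *: opara x y + opara x' y.
Proof.
elim/oct_ind: x => *; elim/oct_ind: x' => *; elim/oct_ind: y => *.
rewrite !opara_mx2 !oscaleE !oaddE !scale_mx2 !add_mx2 opara_mx2.
by congr (mx2 _ _ _ _, mx2 _ _ _ _); ring.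
Qed.

Lemma opara_linr k x y y' : opara x (k *: y + y') = k *: opara x y + opara x y'.
Proof.
elim/oct_ind: x => *; elim/oct_ind: y => *; elim/oct_ind: y' => *.
rewrite !opara_mx2 !oscaleE !oaddE !scale_mx2 !add_mx2 opara_mx2.
by congr (mx2 _ _ _ _, mx2 _ _ _ _); ring.
Qed.

Lemma onorm_scale k x : onorm (k *: x) = k ^+ 2 * onorm x.
Proof.
elim/oct_ind: x => *.
by rewrite oscaleE !scale_mx2 /onorm /= !det_mx2; ring.
Qed.

Lemma onorm2_linl k x x' y :
  onorm2 (k *: x + x') y = k * onorm2 x y + onorm2 x' y.
Proof.
elim/oct_ind: x => *; elim/oct_ind: x' => *; elim/oct_ind: y => *.
by rewrite !oscaleE !oaddE !scale_mx2 !add_mx2 !onorm2_mx2; ring.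
Qed.

Lemma onorm2C x y : onorm2 x y = onorm2 y x.
Proof. by rewrite /onorm2 (addrC x) addrAC. Qed.

(** The norm form is the dot product of the coordinates up to this signed
    permutation of the entries, hence unimodular; see [odualP]. *)
Definition odual x : oct K :=
  (mx2 (x.1 1 1) (- x.1 1 0) (- x.1 0 1) (x.1 0 0),
   mx2 (x.2 1 1) (- x.2 1 0) (- x.2 0 1) (x.2 0 0)).

Definition odot x y : K :=
  \sum_i \sum_j x.1 i j * y.1 i j + \sum_i \sum_j x.2 i j * y.2 i j.

Lemma odualP x y : onorm2 x (odual y) = odot x y.
Proof.
elim/oct_ind: x => *; elim/oct_ind: y => *.
rewrite /odual /= !mxE /= onorm2_mx2 /odot !big_ord_recl !big_ord0 !mxE /=.
by ring.
Qed.

Lemma onorm_odual x : onorm (odual x) = onorm x.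
Proof.
by elim/oct_ind: x => *; rewrite /odual /onorm /= !mxE /= !det_mx2; ring.
Qed.

Lemma opara_assoc x y z : onorm2 (opara x y) z = onorm2 x (opara y z).
Proof.
elim/oct_ind: x => *; elim/oct_ind: y => *; elim/oct_ind: z => *.
by rewrite !opara_mx2 !onorm2_mx2; ring.
Qed.

(** The flexible laws: they encode the alternative laws of the octonions. *)
Lemma opara_flex x y : opara (opara x y) x = onorm x *: y.
Proof.
elim/oct_ind: x => *; elim/oct_ind: y => *.
rewrite !opara_mx2 /onorm /= !det_mx2 oscaleE !scale_mx2.
by congr (mx2 _ _ _ _, mx2 _ _ _ _); ring.
Qed.

Lemma opara_flexr x y : opara x (opara y x) = onorm x *: y.
Proof.
elim/oct_ind: x => *; elim/oct_ind: y => *.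
rewrite !opara_mx2 /onorm /= !det_mx2 oscaleE !scale_mx2.
by congr (mx2 _ _ _ _, mx2 _ _ _ _); ring.
Qed.

Lemma onorm_para x y : onorm (opara x y) = onorm x * onorm y.
Proof.
elim/oct_ind: x => *; elim/oct_ind: y => *.
by rewrite opara_mx2 /onorm /= !det_mx2; ring.
Qed.

Lemma oscal_trace x y z :
  oscal (omul (omul x y) z + omul (oconj z) (omul (oconj y) (oconj x)))
    = onorm2 (opara x y) z.
Proof.
elim/oct_ind: x => *; elim/oct_ind: y => *; elim/oct_ind: z => *.
rewrite opara_mx2 onorm2_mx2 /oscal /= /omul /oconj /=.
rewrite !hconj_mx2 !opp_mx2 !mul_mx2 !opp_mx2 !add_mx2.
rewrite !mul_mx2 !opp_mx2 !add_mx2 !mxE /=.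
by ring.
Qed.

End Entries.

Arguments opara : simpl never.

(** * Split composition algebras in coordinates *)

Lemma eq_of_sub (V : zmodType) (x y a b : V) : a = b -> x - y = a - b -> x = y.
Proof. by move=> -> /eqP; rewrite subrr subr_eq0 => /eqP. Qed.

Lemma sum_ord2 (V : nmodType) (F : 'I_2 -> V) : \sum_i F i = F 0 + F 1.
Proof.
rewrite big_ord_recl big_ord1; congr (F _ + F _); exact: val_inj.
Qed.

Lemma sum_ord3 (V : nmodType) (F : 'I_3 -> V) :
  \sum_i F i = F 0 + F 1 + F 2%:R.
Proof.
rewrite big_ord_recl big_ord_recl big_ord1 addrA.
by congr (F _ + F _ + F _); exact: val_inj.
Qed.

Lemma linear_ops (K : comNzRingType) (V W : lmodType K) (f : V -> W) :
    (forall k u v, f (k *: u + v) = k *: f u + f v) ->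
  [/\ f 0 = 0, forall u v, f (u + v) = f u + f v, forall u, f (- u) = - f u
    & forall k u, f (k *: u) = k *: f u].
Proof.
move=> fl; have f0 : f 0 = 0 by rewrite -(addNr 0) -scaleN1r fl scaleN1r addNr.
have fZ k u : f (k *: u) = k *: f u by rewrite -[k *: u]addr0 fl f0 addr0.
split=> // [u v | u]; first by rewrite -[u]scale1r fl !scale1r.
by rewrite -scaleN1r fZ scaleN1r.
Qed.

Section Composition.
Variables (K : comNzRingType) (C : composition).
Local Notation V := 'rV[K]_(cdim C).
Implicit Types (k : K) (u v w : V).

(** The left inverse of [celt], meant for octonions in its image. *)
Definition ccoord : oct K -> V :=
  match C return oct K -> 'rV[K]_(cdim C) with
  | CompB => fun x => \row_i x.1 i i
  | CompH => fun x => mxvec x.1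
  | CompO => fun x => row_mx (mxvec x.1) (mxvec x.2)
  end.

Lemma celtK u : ccoord (celt u) = u.
Proof.
rewrite /ccoord /celt; case: C u => /= u.
- by apply/rowP => i; rewrite !mxE eqxx mulr1n.
- exact: vec_mxK.
- by rewrite !vec_mxK hsubmxK.
Qed.

Lemma celt_inj : injective (@celt K C).
Proof. exact: can_inj celtK. Qed.

Lemma celt_linear k u v : celt (k *: u + v) = k *: celt u + celt v.
Proof.
rewrite /celt; case: C u v => /= u v.
- by rewrite oscaleE oaddE linearP scaler0 addr0.
- by rewrite oscaleE oaddE linearP scaler0 addr0.
- by rewrite oscaleE oaddE !linearP.
Qed.

Lemma diag_mx2 (u : 'rV[K]_2) : diag_mx u = mx2 (u 0 0) 0 0 (u 0 1).
Proof. by apply: mx2P; rewrite !mxE /= ?mulr1n ?mulr0n. Qed.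

Definition cpara u v : V := ccoord (opara (celt u) (celt v)).

Lemma mx20 : 0 = mx2 0 0 0 0 :> 'M[K]_2.
Proof. by apply: mx2P; rewrite !mxE. Qed.

(** The three subspaces are stable under the para-product, so identities between
    octonions restrict to them along the injection [celt]. *)
Lemma celt_cpara u v : celt (cpara u v) = opara (celt u) (celt v).
Proof.
rewrite /cpara; move oE: (opara _ _) => o; move: oE.
rewrite /ccoord /celt; case: C u v => /= u v.
- rewrite !diag_mx2 mx20 opara_mx2 => <- /=; rewrite !mxE.
  by congr (mx2 _ _ _ _, mx2 _ _ _ _); ring.
- rewrite mxvecK; move: (vec_mx u) (vec_mx v) => A B.
  rewrite (mx2_eta A) (mx2_eta B) mx20 opara_mx2 => <-.
  by congr (_, mx2 _ _ _ _); ring.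
- by move=> _; rewrite row_mxKl row_mxKr !mxvecK; case: (o).
Qed.

Definition cnorm u : K := onorm (celt u).
Definition cform u v : K := onorm2 (celt u) (celt v).

Lemma cpara_linl k u v w : cpara (k *: u + v) w = k *: cpara u w + cpara v w.
Proof.
by apply: celt_inj; rewrite celt_linear !celt_cpara celt_linear opara_linl.
Qed.

Lemma cpara_linr k u v w : cpara w (k *: u + v) = k *: cpara w u + cpara w v.
Proof.
by apply: celt_inj; rewrite celt_linear !celt_cpara celt_linear opara_linr.
Qed.

Lemma cform_linl k u v w : cform (k *: u + v) w = k * cform u w + cform v w.
Proof. by rewrite /cform celt_linear onorm2_linl. Qed.

Lemma cformC u v : cform u v = cform v u.
Proof. exact: onorm2C. Qed.

Lemma cparaDl u v w : cpara (u + v) w = cpara u w + cpara v w.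
Proof. by have [_ -> _ _] := linear_ops (fun k u v => cpara_linl k u v w). Qed.

Lemma cparaDr u v w : cpara w (u + v) = cpara w u + cpara w v.
Proof. by have [_ -> _ _] := linear_ops (fun k u v => cpara_linr k u v w). Qed.

Lemma cparaZl k u w : cpara (k *: u) w = k *: cpara u w.
Proof. by have [_ _ _ ->] := linear_ops (fun k u v => cpara_linl k u v w). Qed.

Lemma cparaZr k u w : cpara w (k *: u) = k *: cpara w u.
Proof. by have [_ _ _ ->] := linear_ops (fun k u v => cpara_linr k u v w). Qed.

Lemma cparaNl u w : cpara (- u) w = - cpara u w.
Proof. by have [_ _ -> _] := linear_ops (fun k u v => cpara_linl k u v w). Qed.

Lemma cparaNr u w : cpara w (- u) = - cpara w u.
Proof. by have [_ _ -> _] := linear_ops (fun k u v => cpara_linr k u v w). Qed.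

Lemma cpara0l w : cpara 0 w = 0.
Proof. by have [-> _ _ _] := linear_ops (fun k u v => cpara_linl k u v w). Qed.

Lemma cpara0r w : cpara w 0 = 0.
Proof. by have [-> _ _ _] := linear_ops (fun k u v => cpara_linr k u v w). Qed.

Let cform_lin w := @linear_ops K V K^o _ (fun k u v => cform_linl k u v w).

Lemma cformDl u v w : cform (u + v) w = cform u w + cform v w.
Proof. by have [_ -> _ _] := cform_lin w. Qed.

Lemma cformZl k u w : cform (k *: u) w = k * cform u w.
Proof. by have [_ _ _ ->] := cform_lin w. Qed.

Lemma cformNl u w : cform (- u) w = - cform u w.
Proof. by have [_ _ -> _] := cform_lin w. Qed.

Lemma cform0l w : cform 0 w = 0.
Proof. by have [-> _ _ _] := cform_lin w. Qed.

Lemma cformDr u v w : cform w (u + v) = cform w u + cform w v.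
Proof. by rewrite !(cformC w) cformDl. Qed.

Lemma cformZr k u w : cform w (k *: u) = k * cform w u.
Proof. by rewrite !(cformC w) cformZl. Qed.

Lemma cformNr u w : cform w (- u) = - cform w u.
Proof. by rewrite !(cformC w) cformNl. Qed.

Lemma cform0r w : cform w 0 = 0.
Proof. by rewrite cformC cform0l. Qed.

Lemma cnormD u v : cnorm (u + v) = cnorm u + cnorm v + cform u v.
Proof.
rewrite /cform /onorm2 /cnorm; have [_ -> _ _] := linear_ops celt_linear.
by ring.
Qed.

Lemma cnormZ k u : cnorm (k *: u) = k ^+ 2 * cnorm u.
Proof.
by rewrite /cnorm; have [_ _ _ ->] := linear_ops celt_linear; exact: onorm_scale.
Qed.

Lemma cnormN u : cnorm (- u) = cnorm u.
Proof. by rewrite -scaleN1r cnormZ sqrrN expr1n mul1r. Qed.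

Lemma cnorm0 : cnorm 0 = 0.
Proof. by rewrite -(scale0r 0) cnormZ expr0n mul0r. Qed.

Lemma cform_cycle u v w : cform (cpara u v) w = cform u (cpara v w).
Proof. by rewrite /cform !celt_cpara opara_assoc. Qed.

(** Rewriting with a fixed last argument brings each value of the invariant
    trilinear form to a chosen cyclic order, after which [ring] applies. *)
Lemma cform_rot u v w : cform (cpara u v) w = cform (cpara w u) v.
Proof. by rewrite [RHS]cform_cycle cformC. Qed.

Lemma cpara_flex u v : cpara (cpara u v) u = cnorm u *: v.
Proof.
apply: celt_inj; rewrite !celt_cpara opara_flex.
by have [_ _ _ ->] := linear_ops celt_linear.
Qed.

Lemma cpara_flexr u v : cpara u (cpara v u) = cnorm u *: v.
Proof.
apply: celt_inj; rewrite !celt_cpara opara_flexr.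
by have [_ _ _ ->] := linear_ops celt_linear.
Qed.

Lemma cform_self u : cform u u = 2%:R * cnorm u.
Proof.
apply: (addrI (cnorm u + cnorm u)); rewrite -cnormD -mulr2n -scaler_nat cnormZ.
by ring.
Qed.

Lemma cpara_flex2 u v w :
  cpara (cpara u v) w + cpara (cpara w v) u = cform u w *: v.
Proof.
have := cpara_flex (u + w) v; rewrite cnormD !(cparaDl, cparaDr) !cpara_flex.
move=> /rowP e; apply/rowP => i; have := e i; rewrite !mxE => {}e.
by apply: (eq_of_sub e); ring.
Qed.

Lemma cpara_flexr2 u v w :
  cpara u (cpara v w) + cpara w (cpara v u) = cform u w *: v.
Proof.
have := cpara_flexr (u + w) v; rewrite cnormD !(cparaDl, cparaDr) !cpara_flexr.
move=> /rowP e; apply/rowP => i; have := e i; rewrite !mxE => {}e.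
by apply: (eq_of_sub e); ring.
Qed.

Lemma cnormM u v : cnorm (cpara u v) = cnorm u * cnorm v.
Proof. by rewrite /cnorm celt_cpara onorm_para. Qed.

(** The dual basis for [cform].  Its vectors have norm 0, so that an elementary
    move along a multiple of one of them changes a diagonal entry linearly. *)
Definition cdual (j : 'I_(cdim C)) : V := ccoord (odual (celt (delta_mx 0 j))).

Lemma celt_cdual j : celt (cdual j) = odual (celt (delta_mx 0 j)).
Proof.
rewrite /cdual /ccoord /celt /odual; move: j; case: C => /= j.
- rewrite diag_mx2 /= !mxE /= ?mulr0n ?mulr1n ?oppr0.
  by congr (_, _); apply: mx2P; rewrite !mxE ?oppr0.
- rewrite mxvecK; congr (_, _).
  by apply: mx2P; rewrite !mxE ?oppr0.
- by rewrite row_mxKl row_mxKr !mxvecK.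
Qed.

Lemma odot_celt u v : odot (celt u) (celt v) = \sum_j u 0 j * v 0 j.
Proof.
have vec (a b : 'rV[K]_(2 * 2)) :
    \sum_i \sum_j vec_mx a i j * vec_mx b i j = \sum_j a 0 j * b 0 j.
  rewrite pair_bigA (reindex _ (curry_mxvec_bij 2 2)).
  by apply: eq_bigr => -[i j] _; rewrite !mxE.
have z : \sum_i \sum_j (0 : 'M[K]_2) i j * (0 : 'M[K]_2) i j = 0.
  by rewrite big1 // => i _; rewrite big1 // => j _; rewrite mxE mul0r.
rewrite /odot /celt; case: C u v => /= u v; rewrite ?z ?addr0 ?vec //.
  rewrite !diag_mx2 !sum_ord2 !mxE /=; ring.
rewrite [RHS](@big_split_ord _ _ _ (2 * 2) (2 * 2)) /=; congr (_ + _).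
  by apply: eq_bigr => i _; rewrite !mxE.
by apply: eq_bigr => i _; rewrite !mxE.
Qed.

Lemma cform_cdual u j : cform u (cdual j) = u 0 j.
Proof.
rewrite /cform celt_cdual odualP odot_celt (bigD1 j) //= big1 => [|i ij].
  by rewrite mxE !eqxx mulr1 addr0.
by rewrite mxE (negbTE ij) andbF mulr0.
Qed.

Lemma cnorm_cdual j : cnorm (cdual j) = 0.
Proof.
have vec (k : 'I_(2 * 2)) : \det (vec_mx (delta_mx 0 k : 'rV[K]_(2 * 2))) = 0.
  case/mxvec_indexP: k => i l; rewrite vec_mx_delta det2 !mxE.
  by case: i l => [[|[|]]] // ? [[|[|]]] // ?; rewrite /= ?mulr0 ?mul0r subr0.
rewrite /cnorm celt_cdual onorm_odual /celt; move: j; case: C => /= j.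
- rewrite diag_mx2 /onorm /= det0 addr0 det_mx2 !mxE /=.
  by case: j => [[|[|]]] // ?; rewrite ?mulr0 ?mul0r subr0.
- by rewrite /onorm /= vec det0 addr0.
- case: (split_ordP j) => i ->.
    by rewrite delta_mx_lshift /onorm /= row_mxKl row_mxKr linear0 vec det0 addr0.
  by rewrite delta_mx_rshift /onorm /= row_mxKl row_mxKr linear0 vec det0 addr0.
Qed.

End Composition.

(** * The cubic norm, its adjoint and trace form *)

Section Rows.
Variable K : comNzRingType.

Definition row3 (a b c : K) : 'rV[K]_3 := \row_i [:: a; b; c]`_i.

Lemma row3_ind (P : 'rV[K]_3 -> Prop) :
  (forall a b c, P (row3 a b c)) -> forall v, P v.
Proof.
move=> h v; suff -> : v = row3 (v 0 0) (v 0 1) (v 0 2%:R) by [].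
apply/rowP => i; rewrite mxE.
by case: i => [[|[|[|]]] // l]; congr (v _ _); exact: val_inj.
Qed.

Lemma row3E a b c :
  (row3 a b c 0 0 = a) * (row3 a b c 0 1 = b) * (row3 a b c 0 2%:R = c).
Proof. by rewrite !mxE. Qed.

Lemma add_row3 a b c a' b' c' :
  row3 a b c + row3 a' b' c' = row3 (a + a') (b + b') (c + c').
Proof. by apply/rowP => i; rewrite !mxE; case: i => [[|[|[|]]]]. Qed.

Lemma scale_row3 k a b c : k *: row3 a b c = row3 (k * a) (k * b) (k * c).
Proof. by apply/rowP => i; rewrite !mxE; case: i => [[|[|[|]]]]. Qed.

Lemma opp_row3 a b c : - row3 a b c = row3 (- a) (- b) (- c).
Proof. by rewrite -scaleN1r scale_row3 !mulN1r. Qed.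

Lemma row30 : row3 0 0 0 = 0.
Proof. by apply/rowP => i; rewrite !mxE; case: i => [[|[|[|]]]]. Qed.

Variable C : composition.
Local Notation V := 'rV[K]_(cdim C).

Definition hmk (a b c : K) (x y z : V) : 'rV[K]_(jdim (Herm C)) :=
  row_mx (row3 a b c) (row_mx x (row_mx y z)).

Lemma hmk_ind (P : 'rV[K]_(jdim (Herm C)) -> Prop) :
  (forall a b c x y z, P (hmk a b c x y z)) -> forall A, P A.
Proof.
move=> h A; rewrite -[A]hsubmxK -[rsubmx A]hsubmxK -[rsubmx (rsubmx A)]hsubmxK.
by elim/row3_ind: (lsubmx A) => a b c; exact: h.
Qed.

Lemma add_hmk a b c x y z a' b' c' x' y' z' :
  hmk a b c x y z + hmk a' b' c' x' y' z' =
    hmk (a + a') (b + b') (c + c') (x + x') (y + y') (z + z').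
Proof. by rewrite /hmk !add_row_mx add_row3. Qed.

Lemma scale_hmk k a b c x y z :
  k *: hmk a b c x y z =
    hmk (k * a) (k * b) (k * c) (k *: x) (k *: y) (k *: z).
Proof. by rewrite /hmk !scale_row_mx scale_row3. Qed.

Lemma opp_hmk a b c x y z :
  - hmk a b c x y z = hmk (- a) (- b) (- c) (- x) (- y) (- z).
Proof. by rewrite -scaleN1r scale_hmk !mulN1r !scaleN1r. Qed.

Lemma hmk0 : hmk 0 0 0 0 0 0 = 0.
Proof. by rewrite /hmk row30 !row_mx0. Qed.

Definition hcomp (A : 'rV[K]_(jdim (Herm C))) :=
  (hdiag A, lsubmx (rsubmx A), lsubmx (rsubmx (rsubmx A)),
   rsubmx (rsubmx (rsubmx A))).

Lemma hcomp_hmk a b c x y z : hcomp (hmk a b c x y z) = (row3 a b c, x, y, z).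
Proof.
by rewrite /hcomp /hdiag /hmk !row_mxKr !row_mxKl.
Qed.

Lemma hdiag_hmk a b c x y z : hdiag (hmk a b c x y z) = row3 a b c.
Proof. by rewrite /hdiag /hmk row_mxKl. Qed.

Lemma hnorm_hmk a b c x y z : hnorm (hmk a b c x y z) =
  a * b * c - a * cnorm x - b * cnorm y - c * cnorm z + cform (cpara x y) z.
Proof.
rewrite /hnorm /hx /hy /hz oscal_trace !omul_conj.
rewrite hdiag_hmk; have [_ -> -> ->] := hcomp_hmk a b c x y z.
by rewrite !row3E /oscal /= !mxE !mulr1n -celt_cpara.
Qed.

Lemma htr_hmk a b c x y z a' b' c' x' y' z' :
  htr (hmk a b c x y z) (hmk a' b' c' x' y' z') =
    a * a' + b * b' + c * c' + cform x x' + cform y y' + cform z z'.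
Proof.
rewrite /htr /hx /hy /hz /hdiag /hmk !row_mxKr !row_mxKl.
by rewrite sum_ord3 !row3E.
Qed.

End Rows.

Section Jordan.
Variables (K : comNzRingType).

(** The sharp map without denominators; [sharpE] identifies the two. *)
Definition jsharp (J : jordan) : 'rV[K]_(jdim J) -> 'rV[K]_(jdim J) :=
  match J return 'rV[K]_(jdim J) -> 'rV[K]_(jdim J) with
  | Defs.Split => fun a => row3 (a 0 1 * a 0 2%:R) (a 0 2%:R * a 0 0) (a 0 0 * a 0 1)
  | Herm C => fun A =>
      let: (d, x, y, z) := hcomp A in
      let a := d 0 0 in let b := d 0 1 in let c := d 0 2%:R in
      hmk (b * c - cnorm x) (c * a - cnorm y) (a * b - cnorm z)
        (cpara y z - a *: x) (cpara z x - b *: y) (cpara x y - c *: z)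
  end.

Lemma jsharp_hmk C a b c (x y z : 'rV[K]_(cdim C)) :
  jsharp (hmk a b c x y z : 'rV[K]_(jdim (Herm C))) =
    hmk (b * c - cnorm x) (c * a - cnorm y) (a * b - cnorm z)
      (cpara y z - a *: x) (cpara z x - b *: y) (cpara x y - c *: z).
Proof. by rewrite /jsharp hcomp_hmk !row3E. Qed.

Variable J : jordan.
Implicit Types (k : K) (A B D : 'rV[K]_(jdim J)).

(* Locked, as a sum with three terms would otherwise be unified with every
   additive rewrite rule. *)
Fact jcross_key : unit. Proof. exact: tt. Qed.

Definition jcross A B :=
  locked_with jcross_key (jsharp (A + B) - jsharp A - jsharp B).

Lemma jcrossE A B : jcross A B = jsharp (A + B) - jsharp A - jsharp B.
Proof. by rewrite /jcross unlock. Qed.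

End Jordan.

Arguments jsharp : simpl never.

Section Cross.
Variables (K : comNzRingType).

Lemma jcross_row3 a b c a' b' c' :
  jcross (row3 a b c : 'rV[K]_(jdim Defs.Split)) (row3 a' b' c') =
    row3 (b * c' + c * b') (c * a' + a * c') (a * b' + b * a').
Proof.
rewrite !jcrossE /jsharp add_row3 !row3E !opp_row3 !add_row3.
by congr row3; ring.
Qed.

Lemma jcross_hmk C a b c (x y z : 'rV[K]_(cdim C)) a' b' c' x' y' z' :
  jcross (hmk a b c x y z : 'rV[K]_(jdim (Herm C))) (hmk a' b' c' x' y' z') =
    hmk (b * c' + c * b' - cform x x') (c * a' + a * c' - cform y y')
      (a * b' + b * a' - cform z z')
      (cpara y z' + cpara y' z - a *: x' - a' *: x)
      (cpara z x' + cpara z' x - b *: y' - b' *: y)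
      (cpara x y' + cpara x' y - c *: z' - c' *: z).
Proof.
rewrite !jcrossE add_hmk !jsharp_hmk !opp_hmk !add_hmk.
rewrite !cnormD !(cparaDl, cparaDr).
congr hmk; try ring; by apply/rowP => i; rewrite !mxE; ring.
Qed.

Variable J : jordan.
Implicit Types (k : K) (A B D : 'rV[K]_(jdim J)).

Lemma jcrossC A B : jcross A B = jcross B A.
Proof. by rewrite !jcrossE [A + B]addrC addrAC. Qed.

Lemma jtr_linl k A B D : jtr (k *: A + B) D = k * jtr A D + jtr B D.
Proof.
case: J A B D => [|C] A B D /=.
  by rewrite !sum_ord3 !mxE; ring.
elim/hmk_ind: A => *; elim/hmk_ind: B => *; elim/hmk_ind: D => *.
rewrite scale_hmk add_hmk !htr_hmk !(cformDl, cformZl); ring.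
Qed.

Lemma jtrC A B : jtr A B = jtr B A.
Proof.
case: J A B => [|C] A B /=; first by rewrite !sum_ord3; ring.
elim/hmk_ind: A => a b c x y z; elim/hmk_ind: B => a' b' c' x' y' z'.
by rewrite !htr_hmk !(cformC x, cformC y, cformC z); ring.
Qed.

Lemma jcross_linl k A B D : jcross (k *: A + B) D = k *: jcross A D + jcross B D.
Proof.
case: J A B D => [|C] A B D.
  elim/row3_ind: A => *; elim/row3_ind: B => *; elim/row3_ind: D => *.
  rewrite scale_row3 add_row3 !jcross_row3 scale_row3 add_row3.
  by congr row3; ring.
elim/hmk_ind: A => *; elim/hmk_ind: B => *; elim/hmk_ind: D => *.
rewrite scale_hmk add_hmk !jcross_hmk scale_hmk add_hmk.
rewrite !(cformDl, cformZl, cparaDl, cparaDr, cparaZl, cparaZr).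
congr hmk; try ring; by apply/rowP => i; rewrite !mxE; ring.
Qed.

(** The trilinear form 6 N(A, B, D) is symmetric. *)
Lemma jcross_cycle A B D : jtr (jcross A B) D = jtr A (jcross B D).
Proof.
case: J A B D => [|C] A B D.
  elim/row3_ind: A => *; elim/row3_ind: B => *; elim/row3_ind: D => *.
  by rewrite !jcross_row3 /= !sum_ord3 !row3E; ring.
elim/hmk_ind: A => a b c x y z; elim/hmk_ind: B => a' b' c' x' y' z'.
elim/hmk_ind: D => a'' b'' c'' x'' y'' z''.
rewrite !jcross_hmk /= !htr_hmk !(cformDl, cformZl, cformNl).
rewrite !(cformDr, cformZr, cformNr) !(cformC _ (cpara _ _)).
rewrite !(cform_rot _ _ x, cform_rot _ _ x', cform_rot _ _ x'').
rewrite !(cform_rot _ _ y, cform_rot _ _ y', cform_rot _ _ y'').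
rewrite !(cform_rot _ _ x, cform_rot _ _ x', cform_rot _ _ x'').
ring.
Qed.

Lemma jsharpZ k A : jsharp (k *: A) = k ^+ 2 *: jsharp A.
Proof.
case: J A => [|C] A.
  elim/row3_ind: A => *.
  by rewrite scale_row3 /jsharp !row3E scale_row3; congr row3; ring.
elim/hmk_ind: A => *; rewrite scale_hmk !jsharp_hmk scale_hmk !cnormZ.
rewrite !(cparaZl, cparaZr).
congr hmk; try ring; by apply/rowP => i; rewrite !mxE; ring.
Qed.

Lemma jnormZ k A : jnorm (k *: A) = k ^+ 3 * jnorm A.
Proof.
case: J A => [|C] A /=; first by rewrite !mxE; ring.
elim/hmk_ind: A => *; rewrite scale_hmk !hnorm_hmk !cnormZ.
by rewrite !(cparaZl, cparaZr) !(cformZl, cformZr); ring.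
Qed.

Lemma jnormD A B :
  jnorm (A + B) = jnorm A + jtr (jsharp A) B + jtr A (jsharp B) + jnorm B.
Proof.
case: J A B => [|C] A B.
  elim/row3_ind: A => *; elim/row3_ind: B => *.
  by rewrite add_row3 /= !sum_ord3 !row3E; ring.
elim/hmk_ind: A => a b c x y z; elim/hmk_ind: B => a' b' c' x' y' z'.
rewrite !jsharp_hmk add_hmk /= !htr_hmk !hnorm_hmk !cnormD.
rewrite !(cparaDl, cparaDr) !(cformDl, cformDr, cformNl, cformNr, cformZl, cformZr).
rewrite !(cformC _ (cpara _ _)) !(cform_rot _ _ x, cform_rot _ _ x').
rewrite !(cform_rot _ _ y, cform_rot _ _ y').
rewrite !(cform_rot _ _ x, cform_rot _ _ x').
ring.
Qed.

Let jtr_lin D := @linear_ops K _ K^o _ (fun k A B => jtr_linl k A B D).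

Lemma jtrDl A B D : jtr (A + B) D = jtr A D + jtr B D.
Proof. by have [_ -> _ _] := jtr_lin D. Qed.

Lemma jtrZl k A D : jtr (k *: A) D = k * jtr A D.
Proof. by have [_ _ _ ->] := jtr_lin D. Qed.

Lemma jtrNl A D : jtr (- A) D = - jtr A D.
Proof. by have [_ _ -> _] := jtr_lin D. Qed.

Lemma jtr0l D : jtr 0 D = 0.
Proof. by have [-> _ _ _] := jtr_lin D. Qed.

Lemma jtrDr A B D : jtr D (A + B) = jtr D A + jtr D B.
Proof. by rewrite !(jtrC D) jtrDl. Qed.

Lemma jtrZr k A D : jtr D (k *: A) = k * jtr D A.
Proof. by rewrite !(jtrC D) jtrZl. Qed.

Lemma jtrNr A D : jtr D (- A) = - jtr D A.
Proof. by rewrite !(jtrC D) jtrNl. Qed.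

Lemma jtr0r D : jtr D 0 = 0.
Proof. by rewrite jtrC jtr0l. Qed.

Let jcross_lin D := linear_ops (fun k A B => jcross_linl k A B D).

Lemma jcrossDl A B D : jcross (A + B) D = jcross A D + jcross B D.
Proof. by have [_ -> _ _] := jcross_lin D. Qed.

Lemma jcrossZl k A D : jcross (k *: A) D = k *: jcross A D.
Proof. by have [_ _ _ ->] := jcross_lin D. Qed.

Lemma jcross0l D : jcross 0 D = 0.
Proof. by have [-> _ _ _] := jcross_lin D. Qed.

Lemma jcrossDr A B D : jcross D (A + B) = jcross D A + jcross D B.
Proof. by rewrite !(jcrossC D) jcrossDl. Qed.

Lemma jcrossZr k A D : jcross D (k *: A) = k *: jcross D A.
Proof. by rewrite !(jcrossC D) jcrossZl. Qed.

Lemma jsharpD A B : jsharp (A + B) = jsharp A + jsharp B + jcross A B.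
Proof. by rewrite !jcrossE -[_ - _ - _]addrA -opprD [RHS]addrC subrK. Qed.

Lemma jcross_self A : jcross A A = 2%:R *: jsharp A.
Proof.
rewrite !jcrossE -mulr2n -scaler_nat jsharpZ -addrA -opprD -mulr2n -scaler_nat.
by rewrite -scalerBl; congr (_ *: _); ring.
Qed.

Lemma jsharp0 : jsharp (0 : 'rV[K]_(jdim J)) = 0.
Proof. by rewrite -(scale0r 0) jsharpZ expr0n !scale0r. Qed.

Lemma jnorm0 : jnorm (0 : 'rV[K]_(jdim J)) = 0.
Proof. by rewrite -(scale0r 0) jnormZ expr0n mul0r. Qed.

Lemma jsharpN A : jsharp (- A) = jsharp A.
Proof. by rewrite -scaleN1r jsharpZ sqrrN expr1n scale1r. Qed.

Lemma jnormN A : jnorm (- A) = - jnorm A.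
Proof. by rewrite -scaleN1r jnormZ -signr_odd mulN1r. Qed.

End Cross.

(** * Compatibility with ring morphisms *)

Section Morphism.
Variables (K L : comNzRingType) (f : {rmorphism K -> L}).

Definition omap (x : oct K) : oct L := (map_mx f x.1, map_mx f x.2).

Lemma map_mx2 a b c d : map_mx f (mx2 a b c d) = mx2 (f a) (f b) (f c) (f d).
Proof. by apply: mx2P; rewrite !mxE. Qed.

Lemma onorm_map x : onorm (omap x) = f (onorm x).
Proof. by rewrite /onorm /= !det_map_mx rmorphD. Qed.

Lemma opara_map x y : opara (omap x) (omap y) = omap (opara x y).
Proof.
elim/oct_ind: x => *; elim/oct_ind: y => *.
have om a b c d a' b' c' d' : omap (mx2 a b c d, mx2 a' b' c' d') =
    (mx2 (f a) (f b) (f c) (f d), mx2 (f a') (f b') (f c') (f d')).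
  by rewrite /omap !map_mx2.
rewrite !om !opara_mx2 om.
by rewrite !(rmorphN, rmorphD, rmorphM, rmorphB).
Qed.

Section Composition.
Variable C : composition.
Implicit Types u v : 'rV[K]_(cdim C).

Lemma celt_map u : celt (map_mx f u) = omap (celt u).
Proof.
rewrite /omap /celt; case: C u => /= u; rewrite ?map_mx0 ?map_diag_mx //.
  by rewrite map_vec_mx.
by rewrite -map_lsubmx -map_rsubmx !map_vec_mx.
Qed.

Lemma cnorm_map u : cnorm (map_mx f u) = f (cnorm u).
Proof. by rewrite /cnorm celt_map onorm_map. Qed.

Lemma cform_map u v : cform (map_mx f u) (map_mx f v) = f (cform u v).
Proof.
apply: (addrI (cnorm (map_mx f u) + cnorm (map_mx f v))).
by rewrite -cnormD -map_mxD !cnorm_map -!rmorphD cnormD.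
Qed.

Lemma cpara_map u v : cpara (map_mx f u) (map_mx f v) = map_mx f (cpara u v).
Proof.
by apply: celt_inj; rewrite celt_cpara !celt_map celt_cpara opara_map.
Qed.

Lemma map_row3 a b c : map_mx f (row3 a b c) = row3 (f a) (f b) (f c).
Proof. by apply/rowP => i; rewrite !mxE; case: i => [[|[|[|]]]]. Qed.

Lemma map_hmk a b c (x y z : 'rV[K]_(cdim C)) :
  map_mx f (hmk a b c x y z) =
    hmk (f a) (f b) (f c) (map_mx f x) (map_mx f y) (map_mx f z).
Proof. by rewrite /hmk !map_row_mx map_row3. Qed.

End Composition.

Variable J : jordan.
Implicit Types A B : 'rV[K]_(jdim J).

Lemma jnorm_map A : jnorm (map_mx f A) = f (jnorm A).
Proof.
case: J A => [|C] A /=; first by rewrite !mxE !rmorphM.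
elim/hmk_ind: A => *; rewrite map_hmk !hnorm_hmk cpara_map cform_map !cnorm_map.
by rewrite !(rmorphD, rmorphN, rmorphM).
Qed.

Lemma jtr_map A B : jtr (map_mx f A) (map_mx f B) = f (jtr A B).
Proof.
case: J A B => [|C] A B /=.
  by rewrite rmorph_sum; apply: eq_bigr => i _; rewrite !mxE rmorphM.
elim/hmk_ind: A => *; elim/hmk_ind: B => *.
by rewrite !map_hmk !htr_hmk !cform_map !(rmorphD, rmorphM).
Qed.

Lemma jsharp_map A : jsharp (map_mx f A) = map_mx f (jsharp A).
Proof.
case: J A => [|C] A.
  by rewrite /jsharp map_row3 !mxE !rmorphM.
elim/hmk_ind: A => *; rewrite map_hmk !jsharp_hmk map_hmk !cpara_map !cnorm_map.
by rewrite !(map_mxD, map_mxN, map_mxZ) !(rmorphD, rmorphN, rmorphM).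
Qed.

End Morphism.

(** * Dual bases *)

Section JordanDual.
Variable K : comNzRingType.

(** The trace form is unimodular, and its dual basis consists of elements of rank
    one. *)
Lemma jdual_exists (J : jordan) (j : 'I_(jdim J)) :
  exists D : 'rV[K]_(jdim J),
    [/\ forall A, jtr A D = A 0 j, jsharp D = 0 & jnorm D = 0].
Proof.
case: J j => [|C] /= j.
  exists (delta_mx 0 j); split.
  - move=> A; rewrite (bigD1 j) //= big1 => [|i ij].
      by rewrite mxE !eqxx mulr1 addr0.
    by rewrite mxE (negbTE ij) andbF mulr0.
  - rewrite /jsharp -row30.
    by case: j => [[|[|[|]]] //= ?]; congr row3; rewrite !mxE ?mulr0 ?mul0r.
  - by case: j => [[|[|[|]]] //= ?]; rewrite !mxE ?mulr0 ?mul0r.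
have S0 := (cform0l, cform0r, cpara0l, cpara0r, cnorm0, scaler0, scale0r,
  mulr0, mul0r, oppr0, addr0, add0r, subr0, mul1r, mulr1).
case: (split_ordP j) => {j} [i|j] ->.
  case: i => [[|[|[|]]] // i];
  [exists (hmk 1 0 0 0 0 0) | exists (hmk 0 1 0 0 0 0) | exists (hmk 0 0 1 0 0 0)];
    rewrite /= ?jsharp_hmk ?hnorm_hmk ?S0 ?hmk0;
    by split=> // A; elim/hmk_ind: A => *; rewrite htr_hmk !S0 row_mxEl !mxE.
case: (split_ordP j) => {j} [i|j] ->; last case: (split_ordP j) => {j} i ->;
  [exists (hmk 0 0 0 (cdual K i) 0 0) | exists (hmk 0 0 0 0 (cdual K i) 0)
  | exists (hmk 0 0 0 0 0 (cdual K i))];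
  rewrite /= ?jsharp_hmk ?hnorm_hmk ?cnorm_cdual ?S0 ?hmk0;
  split=> // A; elim/hmk_ind: A => *; rewrite htr_hmk !S0 cform_cdual;
  by rewrite /hmk ?row_mxEr ?row_mxEl.
Qed.

End JordanDual.

(** * The quartic form and its differential *)

Section Freudenthal.
Variables (K : comNzRingType) (J : jordan).
Implicit Types (x w : 'rV[K]_(mdim J)) (A B D : 'rV[K]_(jdim J)).

Lemma melt_ind (P : 'rV[K]_(mdim J) -> Prop) :
  (forall al be A B, P (melt al be A B)) -> forall x, P x.
Proof.
move=> h x; suff -> : x = melt (malpha x) (mbeta x) (mA x) (mB x) by [].
by rewrite /melt /malpha /mbeta /mA /mB -!mx11_scalar !hsubmxK.
Qed.

Lemma malpha_melt al be A B : malpha (melt al be A B) = al.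
Proof. by rewrite /malpha /melt row_mxKl mxE mulr1n. Qed.

Lemma mbeta_melt al be A B : mbeta (melt al be A B) = be.
Proof. by rewrite /mbeta /melt row_mxKr row_mxKl mxE mulr1n. Qed.

Lemma mA_melt al be A B : mA (melt al be A B) = A.
Proof. by rewrite /mA /melt !row_mxKr row_mxKl. Qed.

Lemma mB_melt al be A B : mB (melt al be A B) = B.
Proof. by rewrite /mB /melt !row_mxKr. Qed.

Definition meltE := (malpha_melt, mbeta_melt, mA_melt, mB_melt).

Lemma add_melt al be A B al' be' A' B' :
  melt al be A B + melt al' be' A' B' =
    melt (al + al') (be + be') (A + A') (B + B').
Proof. by rewrite /melt !add_row_mx !raddfD. Qed.

Lemma scale_melt k al be A B :
  k *: melt al be A B = melt (k * al) (k * be) (k *: A) (k *: B).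
Proof. by rewrite /melt !scale_row_mx !scale_scalar_mx. Qed.

(** q' without denominators; see [quartic'E]. *)
Definition qform x : K :=
  (malpha x * mbeta x - jtr (mA x) (mB x)) ^+ 2
    + 4%:R * (malpha x * jnorm (mA x)) + 4%:R * (mbeta x * jnorm (mB x))
    - 4%:R * jtr (jsharp (mA x)) (jsharp (mB x)).

(** Half the derivative of [qform] at [x] in the direction [w]. *)
Definition qdiff x w : K :=
  (malpha x * mbeta x - jtr (mA x) (mB x))
    * (malpha x * mbeta w + malpha w * mbeta x
         - jtr (mA x) (mB w) - jtr (mA w) (mB x))
  + 2%:R * (malpha w * jnorm (mA x) + malpha x * jtr (jsharp (mA x)) (mA w)
            + mbeta w * jnorm (mB x) + mbeta x * jtr (jsharp (mB x)) (mB w)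
            - jtr (jcross (mA x) (mA w)) (jsharp (mB x))
            - jtr (jsharp (mA x)) (jcross (mB x) (mB w))).

(** Two scalars are needed: (k, 1) computes the polarization q(x,x,x,w) by finite
    differences, and (1, 'X) computes partial derivatives. *)
Lemma qform_taylor x w : exists c d, forall s t,
  qform (s *: x + t *: w) = s ^+ 4 * qform x + s ^+ 3 * t * (2%:R * qdiff x w)
    + s ^+ 2 * t ^+ 2 * c + s * t ^+ 3 * d + t ^+ 4 * qform w.
Proof.
elim/melt_ind: x => a b A B; elim/melt_ind: w => a' b' A' B'.
exists ((a * b' + a' * b - jtr A B' - jtr A' B) ^+ 2
  + 2%:R * (a * b - jtr A B) * (a' * b' - jtr A' B')
  + 4%:R * (a * jtr A (jsharp A') + a' * jtr (jsharp A) A')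
  + 4%:R * (b * jtr B (jsharp B') + b' * jtr (jsharp B) B')
  - 4%:R * (jtr (jsharp A) (jsharp B') + jtr (jsharp A') (jsharp B)
            + jtr (jcross A A') (jcross B B'))).
exists (2%:R * (a' * b' - jtr A' B') * (a * b' + a' * b - jtr A B' - jtr A' B)
  + 4%:R * (a * jnorm A' + a' * jtr A (jsharp A') + b * jnorm B'
            + b' * jtr B (jsharp B') - jtr (jcross A A') (jsharp B')
            - jtr (jsharp A') (jcross B B'))).
move=> s t; rewrite !scale_melt add_melt /qform /qdiff !meltE.
rewrite !jnormD !jsharpD !jnormZ !jsharpZ !jcrossZl !jcrossZr.
rewrite !(jtrDl, jtrDr, jtrZl, jtrZr).
ring.
Qed.

Lemma qdiff_linr k x w w' : qdiff x (k *: w + w') = k * qdiff x w + qdiff x w'.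
Proof.
elim/melt_ind: x => a b A B; elim/melt_ind: w => a' b' A' B'.
elim/melt_ind: w' => a'' b'' A'' B''; rewrite scale_melt add_melt.
rewrite /qdiff !meltE !(jcrossDr, jcrossZr) !(jtrDl, jtrDr, jtrZl, jtrZr).
ring.
Qed.

Lemma symp_linl k x y w : symp (k *: x + y) w = k * symp x w + symp y w.
Proof.
elim/melt_ind: x => a b A B; elim/melt_ind: w => a' b' A' B'.
elim/melt_ind: y => a'' b'' A'' B''; rewrite scale_melt add_melt.
rewrite /symp !meltE !(jtrDl, jtrZl); ring.
Qed.

Lemma sympC x y : symp x y = - symp y x.
Proof. by rewrite /symp (jtrC (mA x)) (jtrC (mB x)); ring. Qed.

Lemma symp_linr k x y w : symp w (k *: x + y) = k * symp w x + symp w y.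
Proof. by rewrite !(sympC w) symp_linl; ring. Qed.

End Freudenthal.

Section Gram.
Variables (K : comUnitRingType) (n : nat).

Lemma linear_coord (l : 'rV[K]_n -> K) (w : 'rV[K]_n) :
  scalar l -> l w = \sum_j w 0 j * l (delta_mx 0 j).
Proof.
move=> ll; have [l0 _ _ _] := @linear_ops K _ K^o l ll.
rewrite {1}(row_sum_delta w).
by elim/big_rec2: _ => [|j a v _ <-] //; exact: ll.
Qed.

(** The matrix with the dual basis in its columns inverts the Gram matrix. *)
Lemma gram_unit (b : 'rV[K]_n -> 'rV[K]_n -> K) :
    (forall u, scalar (b u)) ->
    (forall j, exists v, forall u, b u v = u 0 j) ->
  \matrix_(i, j) b (delta_mx 0 i) (delta_mx 0 j) \in unitmx.
Proof.
move=> bl /fin_all_exists[v bv]; set G := \matrix_(i, j) _.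
suff: G *m (\matrix_(i, j) v j 0 i) = 1%:M by move/mulmx1_unit => [].
apply/matrixP => i j; transitivity (b (delta_mx 0 i) (v j)).
  rewrite (linear_coord _ (bl _)) mxE.
  by apply: eq_bigr => k _; rewrite !mxE mulrC.
by rewrite bv !mxE eqxx eq_sym.
Qed.

End Gram.

(** * The definitions by polarization and duality *)

Section Quartic.
Variables (K : comUnitRingType) (J : jordan).
Hypotheses (u2 : 2%:R \is a @GRing.unit K) (u3 : 3%:R \is a @GRing.unit K).

Lemma jnorm3_sharp (A B : 'rV[K]_(jdim J)) :
  3%:R * jnorm3 A A B = jtr (jsharp A) B.
Proof.
have u6 : 3`!%:R \is a @GRing.unit K by rewrite (natrM _ 3 2) unitrM u3.
rewrite /jnorm3 /polar /= !add0r mulrA.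
apply: (canLR (mulrK u6)).
have -> : A + A = 2%:R *: A by rewrite scaler_nat mulr2n.
have -> : 3`!%:R = 6%:R :> K by [].
rewrite !jnormD !jnormZ !jsharpZ !jtrZl jnorm0.
ring.
Qed.

Lemma sharpE (A : 'rV[K]_(jdim J)) : sharp A = jsharp A.
Proof.
have br (B : 'rV[K]_(jdim J)) : scalar (jtr B).
  by move=> k D E; rewrite jtrDr jtrZr.
symmetry; apply/dualizeP => //.
- by move=> D k B E; exact: jtr_linl.
- by move=> k B D; rewrite !jnorm3_sharp; exact: br.
- apply: gram_unit => // j; have [D [hD _ _]] := jdual_exists K j.
  by exists D.
- by move=> B; rewrite jnorm3_sharp.
Qed.

Lemma quarticE (x : 'rV[K]_(mdim J)) : quartic x = - (2%:R * qform x).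
Proof. by rewrite /quartic !sharpE /qform; ring. Qed.

Lemma quartic'E (x : 'rV[K]_(mdim J)) : quartic' x = qform x.
Proof. by rewrite /quartic' quarticE mulrN opprK mulKr. Qed.

(** The third difference in k of the quartic polynomial q(k x + w) - q(k x) is 6
    times its coefficient of k^3: the k^4 terms cancel. *)
Lemma quartic4E (x w : 'rV[K]_(mdim J)) : quartic4 x x x w = - qdiff x w.
Proof.
have u24 : 4`!%:R \is a @GRing.unit K.
  by rewrite (natrM _ (2 * 2 * 2) 3) !natrM !unitrM u2 u3.
have [c [d e]] := qform_taylor x w.
rewrite /quartic4 /polar /= !add0r.
apply: (canLR (mulrK u24)); rewrite !quarticE.
have e2 : x + x = 2%:R *: x by rewrite scaler_nat mulr2n.
have e3 : x + x + x = 3%:R *: x by rewrite scaler_nat !mulrS addr0 addrA.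
have -> : 4`!%:R = 24%:R :> K by [].
have e1 s := e s 1; have e0 s := e s 0.
move: (e1 3%:R) (e1 2%:R) (e1 1) (e0 3%:R) (e0 2%:R) (e0 0).
rewrite !scale1r !scale0r !addr0 e3 e2 => -> -> -> -> -> ->; ring.
Qed.

End Quartic.

Section MorphismFreudenthal.
Variables (K L : comNzRingType) (f : {rmorphism K -> L}) (J : jordan).
Implicit Types x w : 'rV[K]_(mdim J).

Lemma map_melt al be (A B : 'rV[K]_(jdim J)) :
  map_mx f (melt al be A B) = melt (f al) (f be) (map_mx f A) (map_mx f B).
Proof. by rewrite /melt !map_row_mx !map_scalar_mx. Qed.

Lemma qform_map x : qform (map_mx f x) = f (qform x).
Proof.
elim/melt_ind: x => *; rewrite map_melt /qform !meltE.
rewrite !jsharp_map !jtr_map !jnorm_map.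
by rewrite !(rmorph_nat, rmorphXn, rmorphD, rmorphN, rmorphM).
Qed.

Lemma jcross_map (A B : 'rV[K]_(jdim J)) :
  jcross (map_mx f A) (map_mx f B) = map_mx f (jcross A B).
Proof. by rewrite !jcrossE -map_mxD !jsharp_map !map_mxB. Qed.

Lemma qdiff_map x w : qdiff (map_mx f x) (map_mx f w) = f (qdiff x w).
Proof.
elim/melt_ind: x => *; elim/melt_ind: w => *; rewrite !map_melt /qdiff !meltE.
rewrite !jcross_map !jsharp_map !jtr_map !jnorm_map.
by rewrite !(rmorph_nat, rmorphD, rmorphN, rmorphM).
Qed.

Lemma symp_map x w : symp (map_mx f x) (map_mx f w) = f (symp x w).
Proof.
elim/melt_ind: x => *; elim/melt_ind: w => *; rewrite !map_melt /symp !meltE.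
by rewrite !jtr_map !(rmorphD, rmorphN, rmorphM).
Qed.

End MorphismFreudenthal.

(** * The gradient *)

Section Gradient.

(** A partial derivative is the derivative at 0 along the line through [v] in a
    coordinate direction.  Both sides are derivations along evaluation at [v], so
    it is enough to compare them on constants and variables. *)
Lemma mderiv_line (n : nat) (K : comNzRingType) (p : {mpoly K[n]})
    (v : 'I_n -> K) (i : 'I_n) :
  (mmap polyC (fun j => (v j)%:P + (i == j)%:R * 'X) p)^`().[0]
    = (mderiv i p).@[v].
Proof.
set h := mmap _ _.
suff: (h p).[0] = p.@[v] /\ (h p)^`().[0] = (mderiv i p).@[v] by case.
have M q r : (h q).[0] = q.@[v] /\ (h q)^`().[0] = (mderiv i q).@[v] ->
    (h r).[0] = r.@[v] /\ (h r)^`().[0] = (mderiv i r).@[v] ->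
    (h (q * r)).[0] = (q * r).@[v]
      /\ (h (q * r))^`().[0] = (mderiv i (q * r)).@[v].
  move=> [q0 q1] [r0 r1]; rewrite [h _]rmorphM derivM mderivM !hornerE /=.
  by rewrite mevalM mevalD !mevalM q0 q1 r0 r1.
have C c : (h c%:MP).[0] = c%:MP.@[v]
    /\ (h c%:MP)^`().[0] = (mderiv i c%:MP).@[v].
  have -> : h c%:MP = c%:P by rewrite /h mmapC.
  by rewrite mevalC mderivC meval0 derivC !hornerE.
have X j : (h 'X_j).[0] = ('X_j).@[v]
    /\ (h 'X_j)^`().[0] = (mderiv i 'X_j).@[v].
  have -> : h 'X_j = (v j)%:P + (i == j)%:R%:P * 'X.
    by rewrite /h mmapX mmap1U polyC_natr.
  rewrite mevalXU mderivX derivD derivM derivX !derivC !hornerE mevalZ mnm1E.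
  split; first by rewrite ?mulr0 ?addr0.
  case: (eqVneq i j) => [->|_]; last by rewrite mul0r.
  rewrite mevalX big1 => [|k _]; first by rewrite ?mulr1 ?mul0r ?add0r.
  by rewrite mnmBE subnn expr0.
elim/mpolyind: p => [|c m p _ _ [p0 p1]].
  exact: (C 0).
have [q0 q1] : (h (c *: 'X_[m])).[0] = (c *: 'X_[m]).@[v]
    /\ (h (c *: 'X_[m]))^`().[0] = (mderiv i (c *: 'X_[m])).@[v].
  rewrite -mul_mpolyC; apply: (M _ _ (C c)); rewrite mpolyXE_id.
  elim/big_rec: _ => [|j q _ hq]; first exact: (C 1).
  apply: (M _ _ _ hq); elim: (m j) => [|k IH]; first exact: (C 1).
  by rewrite exprS; exact: (M _ _ (X j) IH).
rewrite [h _]raddfD derivD mderivD !mevalD !hornerD /=.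
by rewrite p0 p1 q0 q1.
Qed.

Lemma nat_unit_mpoly (n k : nat) :
  (0 < k)%N -> k%:R \is a @GRing.unit {mpoly rat[n]}.
Proof.
move=> k0; rewrite -(rmorph_nat (@mpolyC n rat : {rmorphism _ -> _})) rmorph_unit //.
by rewrite unitfE pnatr_eq0 -lt0n.
Qed.

Lemma rat_unit (k : nat) : (0 < k)%N -> k%:R \is a @GRing.unit rat.
Proof. by move=> k0; rewrite unitfE pnatr_eq0 -lt0n. Qed.

Lemma gradE (J : jordan) (x : 'rV[rat]_(mdim J)) i :
  grad x 0 i = 2%:R * qdiff x (delta_mx 0 i).
Proof.
rewrite mxE -mderiv_line; set h := mmap _ _.
rewrite /quartic'_poly quartic'E ?nat_unit_mpoly // -[h _](qform_map h).
have -> : map_mx h (\row_j 'X_j) =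
    1 *: map_mx polyC x + 'X *: map_mx polyC (delta_mx 0 i).
  apply/rowP => j; rewrite !mxE /h mmapX mmap1U mul1r mulrC eqxx /= eq_sym.
  by rewrite rmorph_nat.
have [c [d ->]] := qform_taylor (map_mx polyC x) (map_mx polyC (delta_mx 0 i)).
rewrite !qform_map qdiff_map !expr1n !mul1r.
have D (a b : rat) (r : {poly rat}) :
    (a%:P + 'X * b%:P + 'X^2 * r)^`().[0] = b.
  by rewrite !derivD !derivM !derivX !derivC !hornerE; rewrite /= !addr0.
rewrite -[RHS](D (qform x) _ (c + 'X * d + 'X^2 * (qform (delta_mx 0 i))%:P)).
congr (_^`().[0]); rewrite polyCM polyC_natr /=; ring.
Qed.

End Gradient.

(** * Divisors of integral vectors *)

Section Gcd.
Variable n : nat.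
Implicit Types (m : 'rV[int]_n) (d : int).

Definition dvdv d m := forall j, (d %| m 0%R j)%Z.

Lemma dvdvP d m : dvdv d m <-> exists m', m = d *: m'.
Proof.
split=> [dm | [m' ->] j]; last by rewrite mxE dvdz_mulr.
exists (\row_j (m 0%R j %/ d)%Z); apply/rowP => j.
by rewrite !mxE mulrC divzK.
Qed.

Lemma dvdv0 m : dvdv 0 m <-> m = 0.
Proof.
split=> [h | -> j]; last by rewrite mxE.
by apply/rowP => j; rewrite mxE; apply/eqP; rewrite -dvd0z.
Qed.

Lemma vgcd0 : vgcd (ratv (0 : 'rV[int]_n)) = 0%N.
Proof.
rewrite /vgcd; set s := (\sum_j _)%N.
have -> : s = 0%N by rewrite /s big1 // => j _; rewrite !mxE.
by rewrite big_mkcond big_ord1 if_same.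
Qed.

Lemma vgcd_dvdv m : dvdv (vgcd (ratv m))%:Z m.
Proof.
have [->|m0] := eqVneq m 0; first by move=> j; rewrite mxE dvdz0.
by apply/dvdvP; case: (vgcdP m0).
Qed.

Lemma vgcd_ge d m : m != 0 -> dvdv d m -> d <= (vgcd (ratv m))%:Z.
Proof. by move=> m0 /dvdvP; case: (vgcdP m0) => _; exact. Qed.

(** The divisor 0, which divides only the zero vector, accounts for the convention
    that the gcd of 0 is 0. *)
Lemma vgcd_eq m m' : (forall d, dvdv d m <-> dvdv d m') ->
  vgcd (ratv m) = vgcd (ratv m').
Proof.
move=> e; have [m0|m0] := eqVneq m 0.
  have /dvdv0 -> : dvdv 0 m' by apply/e/dvdv0.
  by rewrite m0.
have m0' : m' != 0 by apply: contra_neq m0 => /dvdv0/e/dvdv0.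
apply/eqP; rewrite -eqz_nat eq_le; apply/andP; split; apply: vgcd_ge => //.
  by apply/e; exact: vgcd_dvdv.
by apply/e; exact: vgcd_dvdv.
Qed.

End Gcd.

Section IntegralGradient.
Variable J : jordan.
Implicit Types x y w : 'rV[int]_(mdim J).

Definition qgrad x : 'rV[int]_(mdim J) := \row_j qdiff x (delta_mx 0 j).

Lemma half_grad x : 2%:R^-1 *: grad (ratv x) = ratv (qgrad x).
Proof.
apply/rowP => j; rewrite mxE gradE mulKr ?rat_unit // !mxE.
by rewrite -(map_delta_mx intr) -[RHS]qdiff_map.
Qed.

(** The intrinsic form of divisibility of the gradient, on which a change of
    coordinates can act. *)
Lemma dvd_qgrad d x : dvdv d (qgrad x) <-> forall w, (d %| qdiff x w)%Z.
Proof.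
split=> [h w | h j]; last by rewrite mxE; exact: h.
rewrite (linear_coord (l := qdiff x) w) => [|k u v]; last exact: qdiff_linr.
apply: rpred_sum => j _; apply: dvdz_mull; move: (h j).
by rewrite mxE.
Qed.

Lemma symp_dual (K : comNzRingType) (j : 'I_(mdim J)) :
  exists v, forall u : 'rV[K]_(mdim J), symp u v = u 0 j.
Proof.
have D0 := (jtr0r, mulr0, mulr1, oppr0, subr0, sub0r, add0r, addr0).
case: (split_ordP j) => {j} i ->.
  exists (melt 0 1 0 0); elim/melt_ind => a b A B; rewrite (ord1 i).
  by rewrite /symp !meltE !D0 /melt row_mxEl mxE mulr1n.
case: (split_ordP i) => {i} i ->.
  exists (melt (- 1) 0 0 0); elim/melt_ind => a b A B; rewrite (ord1 i).
  by rewrite /symp !meltE !D0 mulrN1 opprK /melt row_mxEr row_mxEl mxE mulr1n.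
case: (split_ordP i) => {i} i ->; have [D [hD _ _]] := jdual_exists K i.
  exists (melt 0 0 0 D); elim/melt_ind => a b A B.
  by rewrite /symp !meltE !D0 hD /melt !row_mxEr row_mxEl.
exists (melt 0 0 (- D) 0); elim/melt_ind => a b A B.
by rewrite /symp !meltE !D0 jtrNr opprK hD /melt !row_mxEr.
Qed.

Definition symp_gram (K : comNzRingType) : 'M[K]_(mdim J) :=
  \matrix_(i, j) symp (delta_mx 0 i) (delta_mx 0 j).

Lemma symp_gram_unit (K : comUnitRingType) : symp_gram K \in unitmx.
Proof.
apply: gram_unit => [u k v w|]; [exact: symp_linr | exact: symp_dual].
Qed.

Lemma Tcube_qgrad x :
  Tcube (ratv x) = ratv (- qgrad x *m invmx (symp_gram int)).
Proof.
rewrite /Tcube /dualize -/(symp_gram rat).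
apply: (canLR (mulmxK (symp_gram_unit rat))).
have -> : symp_gram rat = map_mx intr (symp_gram int).
  apply/matrixP => i j; rewrite !mxE -symp_map !map_delta_mx //.
rewrite -map_mxM mulmxKV ?symp_gram_unit //; apply/rowP => j.
rewrite !mxE quartic4E ?rat_unit // -(map_delta_mx intr) /ratv qdiff_map.
by rewrite rmorphN.
Qed.

Lemma vgcd_Tcube x :
  vgcd (Tcube (ratv x)) = vgcd (2%:R^-1 *: grad (ratv x)).
Proof.
rewrite Tcube_qgrad half_grad; apply: vgcd_eq => d; rewrite !dvdvP.
split=> [[m mE] | [m ->]]; last first.
  by exists (- m *m invmx (symp_gram int)); rewrite -scalerN scalemxAl.
exists (- (m *m symp_gram int)); rewrite scalerN scalemxAl -mE.
by rewrite mulmxKV ?symp_gram_unit // opprK.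
Qed.

End IntegralGradient.

(** * The three binary quadratic forms *)

Section SplitProjective.
Local Notation M := (melt (J := Defs.Split)).

(** The derivative of q' = P^2 - 4 A C, where A, P, C are the coefficients of the
    form with index [i]. *)
Lemma qdiff_split (K : comNzRingType) (i j k : 'I_3) (al be al' be' : K)
    (a b a' b' : 'rV[K]_(jdim Defs.Split)) : i != j -> i != k -> j != k ->
  qdiff (melt al be a b) (melt al' be' a' b') =
    (- (a 0 i * b 0 i) + a 0 j * b 0 j + a 0 k * b 0 k - al * be)
      * (- (a' 0 i * b 0 i + a 0 i * b' 0 i) + (a' 0 j * b 0 j + a 0 j * b' 0 j)
         + (a' 0 k * b 0 k + a 0 k * b' 0 k) - (al' * be + al * be'))
    - 2%:R * ((al * a 0 i - b 0 j * b 0 k)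
                * (be' * b 0 i + be * b' 0 i - a' 0 j * a 0 k - a 0 j * a' 0 k)
              + (be * b 0 i - a 0 j * a 0 k)
                * (al' * a 0 i + al * a' 0 i - b' 0 j * b 0 k - b 0 j * b' 0 k)).
Proof.
elim/row3_ind: a => a0 a1 a2; elim/row3_ind: b => b0 b1 b2.
elim/row3_ind: a' => a0' a1' a2'; elim/row3_ind: b' => b0' b1' b2'.
rewrite /qdiff !meltE /jsharp /jtr /jnorm !jcross_row3 !sum_ord3 !row3E.
case: i j k => [[|[|[|]]] //= ?] [[|[|[|]]] //= ?] [[|[|[|]]] //= ?] _ _ _.
all: rewrite !mxE /=; ring.
Qed.

Lemma primitive_dvd (d k a b c : int) : primitive_form a b c ->
  (d %| k * a)%Z -> (d %| k * b)%Z -> (d %| k * c)%Z -> (d %| k)%Z.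
Proof.
rewrite /primitive_form; have [u [v <-]] := Bezoutz a b.
have [s [t <-]] := Bezoutz (u * a + v * b) c => e ka kb kc.
have -> : k = s * u * (k * a) + s * v * (k * b) + t * (k * c).
  by rewrite -[LHS]mulr1 -e; ring.
by rewrite !rpredD // dvdz_mull.
Qed.

Lemma split_dvd_qdiff (d al be : int) (a b : 'rV[int]_(jdim Defs.Split))
    (i j k : 'I_3) :
    i != j -> i != k -> j != k ->
    (d %| (al * a 0 i - b 0 j * b 0 k)%R)%Z ->
    (d %| (- (a 0 i * b 0 i) + a 0 j * b 0 j + a 0 k * b 0 k - al * be)%R)%Z ->
    (d %| (be * b 0 i - a 0 j * a 0 k)%R)%Z ->
  forall w, (d %| qdiff (melt al be a b) w)%Z.
Proof.
move=> ij ik jk dA dP dC; elim/melt_ind => al' be' a' b'.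
rewrite (qdiff_split _ _ _ _ _ _ _ _ ij ik jk) rpredB //.
  exact: dvdz_mulr.
by rewrite dvdz_mull // rpredD // dvdz_mulr.
Qed.

(** Up to a signed permutation of the coordinates, the half gradient at x, seen as
    a 2 x 2 x 2 cube, is x transformed in one of its three directions by the matrix
    ((P, 2 C), (- 2 A, - P)) of the corresponding form.  If d divides it, the two
    slices of x in that direction are related modulo d; multiplying the relations
    by the slices shows that d divides the product of each entry of the matrix and
    each minor of the slices, and the minors generate the coefficients of the
    other two forms.  Thus d divides 2 s t for each coefficient s of the first form
    and t of the second. *)
Lemma split_projective_dvd2 (d al be : int) (a b : 'rV[int]_(jdim Defs.Split)) :
    split_projective al be a b ->
    (forall w, (d %| qdiff (melt al be a b) w)%Z) ->
  (d %| 2)%Z.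
Proof.
move=> pr; have := pr 1 0 2%:R isT isT isT; have := pr 0 1 2%:R isT isT isT.
elim/row3_ind: a {pr} => a0 a1 a2; elim/row3_ind: b => b0 b1 b2.
rewrite !row3E => p0 p1 h.
have h2 w t : t = qdiff (M al be (row3 a0 a1 a2) (row3 b0 b1 b2)) w ->
    (d %| t)%Z by move=> ->.
have E (al' be' a0' a1' a2' b0' b1' b2' : int) t :=
  h2 (M al' be' (row3 a0' a1' a2') (row3 b0' b1' b2')) t.
(* Each case names a vector w, linear in x, at which [qdiff x] equals the product
   of a coefficient of the first form and one of the second, or its double. *)
apply: (primitive_dvd p0); apply: (primitive_dvd p1).
- apply: (E 0 b2 0 0 al 0 0 0).
  rewrite (@qdiff_split _ 0 1 2%:R) // !row3E; ring.
- rewrite -mulrA; apply: dvdz_mull; apply: (E 0 (- a0) 0 0 (- b1) 0 0 0).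
  rewrite (@qdiff_split _ 0 1 2%:R) // !row3E; ring.
- apply: (E 0 0 0 (- a0) 0 (- b1) 0 0).
  rewrite (@qdiff_split _ 0 1 2%:R) // !row3E; ring.
- rewrite -mulrA; apply: dvdz_mull; apply: (E 0 (- a1) 0 0 (- b0) 0 0 0).
  rewrite (@qdiff_split _ 0 1 2%:R) // !row3E; ring.
- rewrite -mulrA; apply: dvdz_mull; apply: (E al 0 (- a0) (- a1) a2 0 0 0).
  rewrite (@qdiff_split _ 0 1 2%:R) // !row3E; ring.
- rewrite -mulrA; apply: dvdz_mull; apply: (E 0 0 0 be 0 a2 0 0).
  rewrite (@qdiff_split _ 0 1 2%:R) // !row3E; ring.
- apply: (E 0 0 (- a1) 0 0 0 (- b0) 0).
  rewrite (@qdiff_split _ 0 1 2%:R) // !row3E; ring.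
- rewrite -mulrA; apply: dvdz_mull; apply: (E 0 0 be 0 0 0 a2 0).
  rewrite (@qdiff_split _ 0 1 2%:R) // !row3E; ring.
- apply: (E a2 0 0 0 0 0 0 be).
  rewrite (@qdiff_split _ 0 1 2%:R) // !row3E; ring.
Qed.

End SplitProjective.

(** * Integral maps preserving the quartic and symplectic forms *)

Section InvariantMaps.
Variable J : jordan.
Local Notation M := 'rV[int]_(mdim J).
Local Notation V := 'rV[int]_(jdim J).
Implicit Types (x y : M) (A B C : V).

Record inv_map (f : M -> M) : Prop := InvMap {
  inv_map_linear : linear f;
  inv_map_qform : forall x, qform (f x) = qform x;
  inv_map_symp : forall x y, symp (f x) (f y) = symp x y }.

(** Invertibility comes for free: the coordinate [u 0 j] is the pairing of [u] with
    some [v j], hence the pairing of [f u] with [f (v j)]. *)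
Lemma in_Inv_inv_map f : inv_map f -> exists2 g, in_Inv g & forall x, x *m g = f x.
Proof.
case=> fl fq fs; have fE x : x *m lin1_mx f = f x.
  apply/rowP => j; rewrite mxE (linear_coord (l := fun u => f u 0 j) x).
    by apply: eq_bigr => i _; rewrite mxE.
  by move=> k u v; rewrite fl !mxE.
exists (lin1_mx f) => //; split=> [|x|x y]; last by rewrite !fE fs.
  have /fin_all_exists[v vE] := symp_dual (J := J) int.
  suff: lin1_mx f *m (\matrix_(i, j) symp (delta_mx 0 i) (f (v j))) = 1%:M.
    by case/mulmx1_unit.
  apply/matrixP => i j; transitivity (symp (f (delta_mx 0 i)) (f (v j))).
    rewrite mxE (linear_coord (l := fun u => symp u (f (v j)))) => [|k u w].
      by apply: eq_bigr => k _; rewrite !mxE.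
    exact: symp_linl.
  by rewrite fs vE !mxE eqxx eq_sym.
by rewrite fE !quarticE ?rat_unit // /ratv !qform_map fq.
Qed.

Definition reach x y := exists g, in_Inv g /\ x *m g = y.

Lemma reach_refl x : reach x x.
Proof.
exists 1%:M; rewrite mulmx1; split=> //.
by split=> [|y|y z]; rewrite ?unitmx1 ?mulmx1.
Qed.

Lemma reach_trans y x z : reach x y -> reach y z -> reach x z.
Proof.
move=> [g [[gu gq gs] gx]] [h [[hu hq hs] hy]]; exists (g *m h).
rewrite mulmxA gx; split=> //; split=> [|w|v w].
- by rewrite unitmx_mul gu.
- by rewrite mulmxA hq.
- by rewrite !mulmxA hs.
Qed.

Lemma reach_map f x : inv_map f -> reach x (f x).
Proof. by move=> /in_Inv_inv_map[g gI gE]; exists g. Qed.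

Lemma inv_map_comp f g : inv_map f -> inv_map g -> inv_map (f \o g).
Proof.
case=> fl fq fs [gl gq gs]; split=> [k x y|x|x y] /=.
- by rewrite gl fl.
- by rewrite fq.
- by rewrite fs.
Qed.

Lemma inv_map_ext f g : f =1 g -> inv_map f -> inv_map g.
Proof.
move=> e [fl fq fs]; split=> [k x y|x|x y]; rewrite -!e //; exact: fl.
Qed.

Lemma inv_map_opp : inv_map -%R.
Proof.
split=> [k x y|x|x y]; first by rewrite opprD scalerN.
- rewrite -scaleN1r; elim/melt_ind: x => a b A B.
  rewrite scale_melt /qform !meltE !scaleN1r !mulN1r jtrNl jtrNr !jnormN.
  by rewrite !jsharpN; ring.
- rewrite -(scaleN1r x) -(scaleN1r y) -[_ *: x]addr0 -[_ *: y]addr0.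
  elim/melt_ind: x => a b A B; elim/melt_ind: y => c d D E.
  rewrite !addr0 !scale_melt /symp !meltE !scaleN1r !jtrNl !jtrNr.
  by ring.
Qed.

(** The Weyl element exchanging the two copies of the Jordan algebra. *)
Definition tau x : M := melt (- mbeta x) (malpha x) (- mB x) (mA x).

Lemma inv_map_tau : inv_map tau.
Proof.
rewrite /tau; split=> [k x y|x|x y].
- elim/melt_ind: x => a b A B; elim/melt_ind: y => c d D E.
  rewrite !(scale_melt, add_melt, meltE) scalerN -!opprD.
  by congr melt; ring.
- elim/melt_ind: x => a b A B.
  by rewrite /qform !meltE jtrNl jnormN jsharpN (jtrC B) (jtrC (jsharp B)); ring.
- elim/melt_ind: x => a b A B; elim/melt_ind: y => c d D E.
  by rewrite /symp !meltE jtrNl jtrNr; ring.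
Qed.

(** These maps form the unipotent radical of the stabilizer of the line spanned
    by (1, 0, 0, 0). *)
Definition phi C x : M :=
  melt (malpha x + jtr (mB x) C + jtr (mA x) (jsharp C) + mbeta x * jnorm C)
    (mbeta x) (mA x + mbeta x *: C) (mB x + jcross (mA x) C + mbeta x *: jsharp C).

Lemma phi_linear C : linear (phi C).
Proof.
move=> k x y; elim/melt_ind: x => a b A B; elim/melt_ind: y => c d D E.
rewrite /phi !(scale_melt, add_melt, meltE) !(jtrDl, jtrZl) jcrossDl jcrossZl.
congr melt; try ring; by apply/rowP => i; rewrite !mxE; ring.
Qed.

(** This uses only the symmetry of the trilinear form; the adjoint identities of
    the Jordan algebra enter through the quartic form. *)
Lemma phi_symp C x y : symp (phi C x) (phi C y) = symp x y.
Proof.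
elim/melt_ind: x => a b A B; elim/melt_ind: y => c d D E.
rewrite /phi /symp !meltE !(jtrDl, jtrDr, jtrZl, jtrZr).
have e1 X : jtr (jcross X C) C = 2%:R * jtr X (jsharp C).
  by rewrite jcross_cycle jcross_self jtrZr.
rewrite (jtrC C (jcross _ _)) !e1 -jcross_cycle (jtrC C (jsharp C)).
rewrite (jtrC (jsharp C) D) (jtrC C E) (jtrC (jcross A D)).
rewrite -(jcross_cycle C) (jcrossC C); ring.
Qed.

(** Additivity makes it enough to treat generators [C] of the Jordan algebra. *)
Lemma phiD C C' x : phi (C + C') x = phi C (phi C' x).
Proof.
elim/melt_ind: x => a b A B; rewrite /phi !meltE jnormD jsharpD.
rewrite !(jtrDl, jtrDr, jtrZl, jtrZr, jcrossDl, jcrossDr, jcrossZl, jcrossZr).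
rewrite (jcross_cycle A C' C) (jcrossC C' C) (jtrC C' (jsharp C)).
rewrite (jtrC C (jsharp C')).
congr melt; try ring; by apply/rowP => i; rewrite !mxE; ring.
Qed.

Lemma inv_map_phiD C C' :
  inv_map (phi C) -> inv_map (phi C') -> inv_map (phi (C + C')).
Proof.
move=> hC hC'; apply: inv_map_ext (inv_map_comp hC hC') => x /=.
by rewrite phiD.
Qed.

(** For [C] of rank one only two adjoint identities enter, both polarizations of
    A## = N(A) A. *)
Lemma phi_rank1 C :
    jsharp C = 0 -> jnorm C = 0 -> (forall A, jnorm (jcross A C) = 0) ->
    (forall A, jsharp (jcross A C) = jtr (jsharp A) C *: C) ->
    (forall A, jcross (jsharp A) (jcross A C)
                 = jnorm A *: C + jtr (jsharp A) C *: A) ->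
  inv_map (phi C).
Proof.
move=> C1 C0 NC SC CC; split; [exact: phi_linear | | exact: phi_symp].
have CA A : jtr (jcross A C) C = 0.
  by rewrite jcross_cycle jcross_self C1 scaler0 jtr0r.
have AC A : jtr A (jcross A C) = 2%:R * jtr (jsharp A) C.
  by rewrite -jcross_cycle jcross_self jtrZl.
elim/melt_ind => a b A B; rewrite /phi /qform !meltE C1 C0.
rewrite !jtr0r !scaler0 !addr0 mulr0 addr0.
rewrite !jsharpD !jnormD !jsharpZ !jnormZ C1 C0 SC NC !scaler0 !jtr0r !addr0.
rewrite !(jtrDl, jtrDr, jtrZl, jtrZr, jcrossDr, jcrossZr, jcrossZl).
have -> : jtr (jsharp A) (jcross B (jcross A C)) =
    jnorm A * jtr C B + jtr (jsharp A) C * jtr A B.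
  by rewrite (jcrossC B) -jcross_cycle CC jtrDl !jtrZl.
have -> : jtr (jcross A C) (jcross B (jcross A C)) =
    2%:R * (jtr (jsharp A) C * jtr C B).
  by rewrite (jcrossC B) -jcross_cycle jcross_self SC scalerA jtrZl mulrA.
rewrite AC !CA (jtrC C (jcross A C)) CA (jtrC C B) (jtrC (jsharp B)).
ring.
Qed.

(** The conjugate of [phi (- C)] by [tau], in the opposite unipotent group. *)
Definition psi C x : M :=
  melt (malpha x)
    (mbeta x + jtr (mA x) C + jtr (mB x) (jsharp C) + malpha x * jnorm C)
    (mA x + jcross (mB x) C + malpha x *: jsharp C) (mB x + malpha x *: C).

Lemma inv_map_psi C : inv_map (phi (- C)) -> inv_map (psi C).
Proof.
move=> hC; have hT := inv_map_tau.
have := inv_map_comp (inv_map_comp inv_map_opp hT) (inv_map_comp hC hT).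
apply: inv_map_ext => x /=; elim/melt_ind: x => a b A B.
rewrite /tau /phi /psi !meltE -scaleN1r scale_melt jsharpN jnormN.
rewrite -!(scaleN1r B) -!(scaleN1r C) !(jtrZl, jtrZr, jcrossZl, jcrossZr).
by congr melt; try ring; apply/rowP => i; rewrite !mxE; ring.
Qed.

(** The group preserving the cubic norm acts on the two copies of the Jordan
    algebra by contragredient maps, and the adjoint intertwines the two actions.
    Surjectivity stands for invertibility. *)
Record jauto (f f' : V -> V) : Prop := JAuto {
  jauto_linl : linear f;
  jauto_linr : linear f';
  jauto_norml : forall A, jnorm (f A) = jnorm A;
  jauto_normr : forall A, jnorm (f' A) = jnorm A;
  jauto_sharpl : forall A, jsharp (f A) = f' (jsharp A);
  jauto_sharpr : forall A, jsharp (f' A) = f (jsharp A);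
  jauto_tr : forall A B, jtr (f A) (f' B) = jtr A B;
  jauto_surjl : forall A, exists B, f B = A;
  jauto_surjr : forall A, exists B, f' B = A }.

Lemma jauto_sym f f' : jauto f f' -> jauto f' f.
Proof. by case=> ? ? ? ? ? ? fT ? ?; split=> // A B; rewrite jtrC fT jtrC. Qed.

Lemma jauto_comp f f' g g' :
  jauto f f' -> jauto g g' -> jauto (f \o g) (f' \o g').
Proof.
case=> fl fr fN fN' fS fS' fT fO fO' [gl gr gN gN' gS gS' gT gO gO'].
split=> [k A B|k A B|A|A|A|A|A B|A|A] /=.
- by rewrite gl fl.
- by rewrite gr fr.
- by rewrite fN gN.
- by rewrite fN' gN'.
- by rewrite fS gS.
- by rewrite fS' gS'.
- by rewrite fT gT.
- by have [B <-] := fO A; have [D <-] := gO B; exists D.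
- by have [B <-] := fO' A; have [D <-] := gO' B; exists D.
Qed.

Definition jlift (f f' : V -> V) x : M :=
  melt (malpha x) (mbeta x) (f (mA x)) (f' (mB x)).

Lemma inv_map_jlift f f' : jauto f f' -> inv_map (jlift f f').
Proof.
case=> fl fr fN fN' fS fS' fT _ _.
split=> [k x y|x|x y]; elim/melt_ind: x => a b A B.
- elim/melt_ind: y => c d D E.
  by rewrite /jlift !(scale_melt, add_melt, meltE) fl fr.
- by rewrite /jlift /qform !meltE fT fN fN' fS fS' (jtrC (f' _)) fT (jtrC (jsharp B)).
- elim/melt_ind: y => c d D E.
  by rewrite /jlift /symp !meltE fT (jtrC (f' B)) fT (jtrC B).
Qed.

(** [phi (f C)] is the conjugate of [phi C] by the lift of the pair. *)
Lemma phi_jauto f f' C :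
  jauto f f' -> inv_map (phi C) -> inv_map (phi (f C)).
Proof.
move=> ff' [_ qC _]; have [_ qf _] := inv_map_jlift ff'.
have [fl fr fN fN' fS fS' fT fO fO'] := ff'.
split; [exact: phi_linear | move=> x | exact: phi_symp].
have [A Ax] := fO (mA x); have [B Bx] := fO' (mB x).
pose y := melt (malpha x) (mbeta x) A B.
have xE : x = jlift f f' y.
  by elim/melt_ind: x @y Ax Bx => a b A' B'; rewrite /jlift !meltE => -> ->.
have [_ fD _ fZ] := linear_ops fl; have [_ fD' fN1' fZ'] := linear_ops fr.
have fX D E : jcross (f D) (f E) = f' (jcross D E).
  by rewrite !jcrossE -fD !fS !(fD', fN1').
suff -> : phi (f C) x = jlift f f' (phi C y) by rewrite qf qC xE qf.
rewrite xE /phi /jlift !meltE fX !fS fN !(fT, fD, fZ, fD', fZ').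
by rewrite (jtrC (f' B)) fT (jtrC C).
Qed.

End InvariantMaps.

(** * Elementary maps of Hermitian matrices *)

Section HermAutomorphisms.
Variable C : composition.
Local Notation V := 'rV[int]_(cdim C).
Local Notation H := 'rV[int]_(jdim (Herm C)).
Implicit Types (u v x y z : V) (A : H).

Definition hcyc A : H :=
  let: (d, x, y, z) := hcomp A in hmk (d 0 1) (d 0 2%:R) (d 0 0) y z x.

(** The congruence A -> E A E^* by an elementary matrix E; the para-product hides
    the conjugations.  [hadd12 u] and [hadd21 (- u)] are dual for the trace form. *)
Definition hadd12 u A : H :=
  let: (d, x, y, z) := hcomp A in
  hmk (d 0 0 + cform z u + d 0 1 * cnorm u) (d 0 1) (d 0 2%:R)
    x (y + cpara u x) (z + d 0 1 *: u).

Definition hadd21 u A : H :=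
  let: (d, x, y, z) := hcomp A in
  hmk (d 0 0) (d 0 1 + cform z u + d 0 0 * cnorm u) (d 0 2%:R)
    (x + cpara y u) y (z + d 0 0 *: u).

Lemma hcyc_hmk a b c x y z : hcyc (hmk a b c x y z) = hmk b c a y z x.
Proof. by rewrite /hcyc hcomp_hmk !row3E. Qed.

Lemma hadd12_hmk u a b c x y z : hadd12 u (hmk a b c x y z) =
  hmk (a + cform z u + b * cnorm u) b c x (y + cpara u x) (z + b *: u).
Proof. by rewrite /hadd12 hcomp_hmk !row3E. Qed.

Lemma hadd21_hmk u a b c x y z : hadd21 u (hmk a b c x y z) =
  hmk a (b + cform z u + a * cnorm u) c (x + cpara y u) y (z + a *: u).
Proof. by rewrite /hadd21 hcomp_hmk !row3E. Qed.

Lemma jauto_hcyc : jauto hcyc hcyc.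
Proof.
have cl : linear hcyc.
  move=> k A B; elim/hmk_ind: A => *; elim/hmk_ind: B => *.
  by rewrite !(hcyc_hmk, scale_hmk, add_hmk).
have cN A : jnorm (hcyc A) = jnorm A.
  elim/hmk_ind: A => *; rewrite hcyc_hmk /= !hnorm_hmk cform_rot.
  by ring.
have cS A : jsharp (hcyc A) = hcyc (jsharp A).
  by elim/hmk_ind: A => *; rewrite hcyc_hmk !jsharp_hmk hcyc_hmk.
have cO A : exists B, hcyc B = A.
  by exists (hcyc (hcyc A)); elim/hmk_ind: A => *; rewrite !hcyc_hmk.
split=> // A B; elim/hmk_ind: A => *; elim/hmk_ind: B => *.
by rewrite !hcyc_hmk /= !htr_hmk; ring.
Qed.

Local Notation lin := (cformDl, cformDr, cformZl, cformZr, cformNl, cformNr,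
  cparaDl, cparaDr, cparaZl, cparaZr, cparaNl, cparaNr).

Lemma jauto_hadd u : jauto (hadd12 u) (hadd21 (- u)).
Proof.
split.
- move=> k A B; elim/hmk_ind: A => *; elim/hmk_ind: B => *.
  rewrite !(hadd12_hmk, scale_hmk, add_hmk) !lin.
  by congr hmk; try ring; apply/rowP => i; rewrite !mxE; ring.
- move=> k A B; elim/hmk_ind: A => *; elim/hmk_ind: B => *.
  rewrite !(hadd21_hmk, scale_hmk, add_hmk) !lin cnormN.
  by congr hmk; try ring; apply/rowP => i; rewrite !mxE; ring.
- move=> A; elim/hmk_ind: A => a b c x y z; rewrite hadd12_hmk /= !hnorm_hmk.
  rewrite !cnormD !cnormZ cnormM !lin cpara_flexr !lin.
  rewrite !(cformC _ (cpara _ _)) !(cform_rot _ _ y, cform_rot _ _ x).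
  rewrite (cformC u z) cform_self; ring.
- move=> A; elim/hmk_ind: A => a b c x y z; rewrite hadd21_hmk /= !hnorm_hmk.
  rewrite !cnormD !cnormZ cnormM !cnormN !lin cpara_flex !lin.
  rewrite !(cformC _ (cpara _ _)) !(cform_rot _ _ y, cform_rot _ _ x).
  rewrite (cformC u z) cform_self; ring.
- move=> A; elim/hmk_ind: A => a b c x y z; rewrite hadd12_hmk !jsharp_hmk.
  rewrite hadd21_hmk !cnormD !cnormZ cnormM !cnormN !lin !(cpara_flex, cpara_flexr).
  rewrite !(cformC _ (cpara _ _)) !(cform_rot _ _ y, cform_rot _ _ x).
  congr hmk; try ring; apply/rowP => i; have/rowP/(_ i) := cpara_flex2 u x z;
    rewrite (cformC u z) !mxE => e; [| ring | ring].
  by apply: (eq_of_sub e); ring.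
- move=> A; elim/hmk_ind: A => a b c x y z; rewrite hadd21_hmk !jsharp_hmk.
  rewrite hadd12_hmk !cnormD !cnormZ cnormM !cnormN !lin.
  rewrite !cpara_flex !cpara_flexr.
  rewrite !(cformC _ (cpara _ _)) !(cform_rot _ _ y, cform_rot _ _ x).
  congr hmk; try ring; apply/rowP => i; have/rowP/(_ i) := cpara_flexr2 z y u;
    rewrite !mxE => e; [ring | | ring].
  by apply: (eq_of_sub (esym e)); ring.
- move=> A B; elim/hmk_ind: A => a b c x y z.
  elim/hmk_ind: B => a' b' c' x' y' z'.
  rewrite hadd12_hmk hadd21_hmk /= !htr_hmk !lin cnormN.
  rewrite (cform_cycle u x y') (cformC u) (cform_cycle x y' u) (cformC u z').
  rewrite cform_self. ring.
- move=> A; exists (hadd12 (- u) A); elim/hmk_ind: A => a b c x y z.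
  rewrite !hadd12_hmk !lin cform_self cnormN.
  by congr hmk; try ring; apply/rowP => i; rewrite !mxE; ring.
- move=> A; exists (hadd21 u A); elim/hmk_ind: A => a b c x y z.
  rewrite !hadd21_hmk !lin cform_self cnormN.
  by congr hmk; try ring; apply/rowP => i; rewrite !mxE; ring.
Qed.

End HermAutomorphisms.

(** * Reduction to B = 0 *)

Lemma rowV_neq0 (K : nmodType) n (w : 'rV[K]_n) :
  w != 0 -> exists j, w 0 j != 0.
Proof.
move=> w0; apply/existsP; apply: contraNT w0; rewrite negb_exists => /forallP h.
by apply/eqP/rowP => j; rewrite mxE; apply/eqP; rewrite -[_ == _]negbK h.
Qed.

Lemma dvdvN n (d : int) (m : 'rV[int]_n) : dvdv d (- m) <-> dvdv d m.
Proof. by split=> h j; have := h j; rewrite mxE rpredN. Qed.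

Section Descent.

Lemma min_abs (T : Type) (P : T -> Prop) (f : T -> int) :
    (exists x, P x /\ f x != 0) ->
  exists x, [/\ P x, f x != 0 & forall y, P y -> f y != 0 -> `|f x| <= `|f y|].
Proof.
move=> [x [Px fx]]; have [n] := ubnP `|f x|%N.
elim: n x Px fx => // n IH x Px fx ltn.
have [[y [Py fy ltyx]]|min_x] :=
    classic (exists y, [/\ P y, f y != 0 & (`|f y| < `|f x|)%N]).
  exact: IH Py fy (leq_trans ltyx ltn).
exists x; split=> // y Py fy; rewrite leNgt; apply/negP => ltyx.
by apply: min_x; exists y; split=> //; rewrite -ltz_nat !abszE.
Qed.

(** One step of the Euclidean algorithm as a divisibility criterion: if [a] did not
    divide [r], then k = - (r / a) and t = - sgn a would give the entry
    a - sgn a (r mod a), which is nonzero and smaller than [a]. *)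
Lemma min_dvd (a r : int) : a != 0 ->
    (forall k t, a + t * (r + k * a) != 0 -> `|a| <= `|a + t * (r + k * a)|) ->
  (a %| r)%Z.
Proof.
move=> a0 min_a; apply: contraT => ndvd.
have m_gt0 : 0 < (r %% a)%Z.
  rewrite lt_def modz_ge0 // andbT; apply: contraNneq ndvd => m0.
  exact/dvdz_mod0P.
have m_lt : (r %% a)%Z < `|a| by exact: ltz_mod.
have := min_a (- (r %/ a)%Z) (- sgz a).
have -> : r + - (r %/ a)%Z * a = (r %% a)%Z by rewrite {1}(divz_eq r a); ring.
move: (r %% a)%Z m_gt0 m_lt => m m_gt0.
by case: (ltgtP a 0) a0 => // [/[dup]/ltr0_sgz -> | /[dup]/gtr0_sgz ->] a_s _; lia.
Qed.

End Descent.

Section Reduction.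
Variable C : composition.
Local Notation V := 'rV[int]_(cdim C).
Local Notation H := 'rV[int]_(jdim (Herm C)).
Local Notation M := 'rV[int]_(mdim (Herm C)).
Implicit Types (A B D : H) (al be d : int).

Local Notation lin0 := (cform0l, cform0r, cpara0l, cpara0r, cnorm0, @scaler0, scale0r,
  mulr0, mul0r, oppr0, addr0, add0r, subr0, sub0r, mul1r, mulr1).

Local Notation lin := (cformDl, cformDr, cformZl, cformZr, cformNl, cformNr,
  cparaDl, cparaDr, cparaZl, cparaZr, cparaNl, cparaNr).

Lemma inv_map_phi_e1 (t : int) : inv_map (phi (hmk t 0 0 0 0 0 : H)).
Proof.
apply: phi_rank1.
- by rewrite jsharp_hmk !lin0 hmk0.
- by rewrite /= hnorm_hmk !lin0.
- by elim/hmk_ind => *; rewrite jcross_hmk /= hnorm_hmk !lin0.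
- elim/hmk_ind => a b c x y z.
  rewrite jcross_hmk !jsharp_hmk /= htr_hmk scale_hmk !lin0.
  rewrite cnormN cnormZ; congr hmk; ring.
elim/hmk_ind => a b c x y z.
rewrite !jsharp_hmk !jcross_hmk /= hnorm_hmk htr_hmk !scale_hmk add_hmk !lin0.
rewrite !lin cform_self cpara_flex cpara_flexr (cform_rot y).
congr hmk; try ring; by apply/rowP => i; rewrite !mxE; ring.
Qed.

(** Every matrix is a sum of conjugates of multiples of the first diagonal unit:
    the cyclic shift reaches the other diagonal units, and applying [hadd12 u] to
    the second one creates the off-diagonal entry [u]. *)
Lemma inv_map_phi A : inv_map (phi A).
Proof.
have e1 t := inv_map_phi_e1 t; have cyc := @phi_jauto _ _ _ _ (jauto_hcyc C).
have e3 t : inv_map (phi (hmk 0 0 t 0 0 0 : H)).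
  by rewrite -(hcyc_hmk t 0 0 0 0 0); exact: cyc.
have e2 t : inv_map (phi (hmk 0 t 0 0 0 0 : H)).
  by rewrite -(hcyc_hmk 0 0 t 0 0 0); exact: cyc.
have ez u : inv_map (phi (hmk 0 0 0 0 0 u : H)).
  have -> : hmk 0 0 0 0 0 u = hadd12 u (hmk 0 1 0 0 0 0)
      + (hmk (- cnorm u) 0 0 0 0 0 + hmk 0 (- 1) 0 0 0 0).
    rewrite hadd12_hmk !add_hmk !lin0 scale1r.
    by congr hmk; rewrite ?subrr.
  apply: inv_map_phiD (inv_map_phiD (e1 _) (e2 _)).
  exact: phi_jauto (jauto_hadd u) (e2 1).
have ey u : inv_map (phi (hmk 0 0 0 0 u 0 : H)).
  by rewrite -(hcyc_hmk 0 0 0 0 0 u); exact: cyc.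
have ex u : inv_map (phi (hmk 0 0 0 u 0 0 : H)).
  by rewrite -(hcyc_hmk 0 0 0 0 u 0); exact: cyc.
elim/hmk_ind: A => a b c x y z.
have -> : hmk a b c x y z = hmk a 0 0 0 0 0 + (hmk 0 b 0 0 0 0
    + (hmk 0 0 c 0 0 0 + (hmk 0 0 0 x 0 0 + (hmk 0 0 0 0 y 0 + hmk 0 0 0 0 0 z)))).
  by rewrite !add_hmk !lin0.
apply: (inv_map_phiD (e1 _)); apply: (inv_map_phiD (e2 _)).
exact: inv_map_phiD (e3 _) (inv_map_phiD (ex _) (inv_map_phiD (ey _) (ez _))).
Qed.

Lemma reach_phi D al be A B : reach (melt al be A B)
  (melt (al + jtr B D + jtr A (jsharp D) + be * jnorm D) be (A + be *: D)
     (B + jcross A D + be *: jsharp D)).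
Proof. by have := reach_map (melt al be A B) (inv_map_phi D); rewrite /phi !meltE. Qed.

Lemma reach_psi D al be A B : reach (melt al be A B)
  (melt al (be + jtr A D + jtr B (jsharp D) + al * jnorm D)
     (A + jcross B D + al *: jsharp D) (B + al *: D)).
Proof.
have := reach_map (melt al be A B) (inv_map_psi (inv_map_phi (- D))).
by rewrite /psi !meltE.
Qed.

Lemma dvdv_hmk d a b c x y z : dvdv d (hmk a b c x y z : H) <->
  [/\ (d %| a)%Z, (d %| b)%Z & (d %| c)%Z] /\ [/\ dvdv d x, dvdv d y & dvdv d z].
Proof.
split=> [/dvdvP[m] | [[]]].
  elim/hmk_ind: m => a' b' c' x' y' z'; rewrite scale_hmk.
  move=> /(congr1 (@hcomp _ _)); rewrite !hcomp_hmk => -[+ -> -> ->].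
  move=> /rowP e; have := e 2%:R; have := e 1; have := e 0; rewrite !mxE /=.
  by move=> -> -> ->; split; rewrite ?dvdz_mulr //; split=> j; rewrite mxE dvdz_mulr.
move=> /dvdzP[a' ->] /dvdzP[b' ->] /dvdzP[c' ->].
move=> [/dvdvP[x' ->] /dvdvP[y' ->] /dvdvP[z' ->]]; apply/dvdvP.
by exists (hmk a' b' c' x' y' z'); rewrite scale_hmk ![_ * d]mulrC.
Qed.

Lemma reach_alpha_neq0 (x : M) : x != 0 -> exists y, reach x y /\ malpha y != 0.
Proof.
have B_neq0 be A B : B != 0 ->
    exists y, reach (melt 0 be A B) y /\ malpha y != 0.
  move=> /rowV_neq0[j Bj]; have [D [hD D1 D0]] := jdual_exists int j.
  exists (phi D (melt 0 be A B)); split; first exact: reach_map (inv_map_phi D).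
  by rewrite /phi !meltE hD D1 jtr0r D0 mulr0 add0r !addr0.
elim/melt_ind: x => al be A B x0.
have [al0|] := eqVneq al 0; last first.
  by exists (melt al be A B); split; [exact: reach_refl | rewrite meltE].
rewrite {}al0 in x0 *; have [B0|/B_neq0] := eqVneq B 0; last exact.
have tauE : reach (melt 0 be A B) (melt (- be) 0 (- B) A).
  by have := reach_map (melt 0 be A B) (inv_map_tau _); rewrite /tau !meltE.
have [be0|be0] := eqVneq be 0; last first.
  by exists (melt (- be) 0 (- B) A); rewrite meltE oppr_eq0.
have [A0|/(B_neq0 0 (- B))[y [ry y0]]] := eqVneq A 0.
  case/eqP: x0; rewrite A0 B0 be0 /melt !raddf0.
  by rewrite !row_mx0.
exists y; split=> //; apply: reach_trans tauE _.
by rewrite be0 oppr0.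
Qed.

(** [al] has the least absolute value of all nonzero first coordinates in the orbit
    of [x]; it need not be attained at [x]. *)
Definition reach_min (x : M) al :=
  al != 0 /\ forall y, reach x y -> malpha y != 0 -> `|al| <= `|malpha y|.

(** [psi] adds multiples of [al] to an entry of [B], and [phi] of the dual rank-one
    element adds multiples of the new entry to [al]. *)
Lemma reach_min_dvd x al be A B :
  reach_min x al -> reach x (melt al be A B) -> dvdv al B.
Proof.
move=> [al0 min_al] rx j; have [D [hD D1 D0]] := jdual_exists int j.
apply: min_dvd => // k t nz.
have rk := reach_trans rx (reach_psi (k *: delta_mx 0 j) al be A B).
have {rk} := reach_trans rk (reach_phi (t *: D) _ _ _ _).
set y := melt _ _ _ _ => ry.
have yE : malpha y = al + t * (B 0 j + k * al).
  rewrite /y meltE (jsharpZ t) (jnormZ t) D1 D0 scaler0 jtr0r !mulr0 !addr0.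
  by rewrite jtrZr hD !mxE !eqxx /= mulr1 (mulrC al).
by have := min_al y ry; rewrite yE; exact.
Qed.

(** As [B] is a multiple of [al], clearing it changes [A] by a multiple of [al];
    [reach_min_dvd_beta] depends on this. *)
Lemma reach_clear x al be A B :
    reach_min x al -> reach x (melt al be A B) ->
  exists be' D, reach x (melt al be' (A + al *: D) 0).
Proof.
move=> mx rx; have /dvdvP[D BE] := reach_min_dvd mx rx.
have := reach_trans rx (reach_psi (- D) al be A B); rewrite {2 3}BE.
rewrite scalerN subrr jcrossZl -[A + _ + _]addrA -scalerDr => ry.
by do 2!eexists; exact: ry.
Qed.

(** [phi D] replaces B = 0 by A x D; with D running through the diagonal units this
    shows all entries of [A] in the place of [B]. *)
Lemma reach_min_dvdA x al be A :
  reach_min x al -> reach x (melt al be A 0) -> dvdv al A.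
Proof.
move=> mx rx.
have cross D : jsharp D = 0 -> jnorm D = 0 -> dvdv al (jcross A D).
  move=> D1 D0; have := reach_trans rx (reach_phi D al be A 0).
  rewrite D1 D0 jtr0l jtr0r scaler0 mulr0 !addr0 add0r.
  exact: reach_min_dvd.
have := cross (hmk 1 0 0 0 0 0); have := cross (hmk 0 1 0 0 0 0).
have := cross (hmk 0 0 1 0 0 0); elim/hmk_ind: A {rx cross} => a b c y z w.
rewrite /= !hnorm_hmk !jsharp_hmk !jcross_hmk !lin0 !hmk0.
rewrite !scale1r => /(_ erefl erefl)/dvdv_hmk[[? ? _] [_ _ /dvdvN ?]].
move=> /(_ erefl erefl)/dvdv_hmk[[? _ _] [_ /dvdvN ? _]].
move=> /(_ erefl erefl)/dvdv_hmk[[_ ? _] [/dvdvN ? _ _]].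
by apply/dvdv_hmk.
Qed.

(** [phi] of a diagonal unit adds [be] to an entry of [A]. *)
Lemma reach_min_dvd_beta x al be A :
  reach_min x al -> reach x (melt al be A 0) -> (al %| be)%Z.
Proof.
move=> mx rx; have := reach_trans rx (reach_phi (hmk 1 0 0 0 0 0) al be A 0).
have -> : jnorm (hmk 1 0 0 0 0 0 : H) = 0 by rewrite /= hnorm_hmk !lin0.
have -> : jsharp (hmk 1 0 0 0 0 0 : H) = 0 by rewrite jsharp_hmk !lin0 hmk0.
rewrite jtr0l jtr0r mulr0 scaler0 !addr0 => /(reach_clear mx)[be' [D rD]].
have := reach_min_dvdA mx rD; have := reach_min_dvdA mx rx.
move=> /dvdvP[A' ->] /dvdvP[A'' e].
have : dvdv al (be *: hmk 1 0 0 0 0 0 : H).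
  apply/dvdvP; exists (A'' - A' - D); rewrite !scalerBr -e.
  by move: (be *: _) => E; apply/rowP => i; rewrite !mxE; ring.
by rewrite scale_hmk mulr1 => /dvdv_hmk[[]].
Qed.

Lemma reach_no_B (x : M) : x != 0 ->
  exists al be A, [/\ reach x (melt al be A 0), 0 < al, (al %| be)%Z & dvdv al A].
Proof.
move=> /reach_alpha_neq0/(min_abs (P := reach x) (f := @malpha _ _))[y [ry y0 min_y]].
have mx : reach_min x (malpha y) by split.
elim/melt_ind: y ry y0 min_y mx => al be A B ry; rewrite meltE => al0 _ mx.
have [be' [D rD]] := reach_clear mx ry.
have := reach_min_dvd_beta mx rD; have := reach_min_dvdA mx rD.
move: (A + _) rD => A' rx dA db.
have [al_gt0|al_le0] := ltP 0 al; first by exists al, be', A'.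
exists (- al), (- be'), (- A'); rewrite oppr_gt0 lt_neqAle al0 al_le0 !dvdzE !abszN.
split=> //; last by apply/dvdvN => j; rewrite dvdzE abszN; exact: dA.
have := reach_trans rx (reach_map _ (inv_map_opp _)).
by rewrite -scaleN1r scale_melt !mulN1r !scaleN1r oppr0.
Qed.

End Reduction.

(** * Diagonalization of Hermitian matrices *)

Section Diagonal.
Variable C : composition.
Local Notation V := 'rV[int]_(cdim C).
Local Notation H := 'rV[int]_(jdim (Herm C)).
Implicit Types (A B : H) (a b c : int) (x y z u : V).

Local Notation lin0 := (cform0l, cform0r, cpara0l, cpara0r, cnorm0, @scaler0,
  scale0r, mulr0, mul0r, oppr0, addr0, add0r, subr0, sub0r, mul1r, mulr1).

Definition jreach A B := exists f f', jauto f f' /\ f A = B.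

Lemma jreach_refl A : jreach A A.
Proof.
exists id, id; split=> //.
by split=> // B; exists B.
Qed.

Lemma jreach_trans B A D : jreach A B -> jreach B D -> jreach A D.
Proof.
move=> [f [f' [ff' <-]]] [g [g' [gg' <-]]].
by exists (g \o f), (g' \o f'); split; first exact: jauto_comp gg' ff'.
Qed.

Lemma jreach_cyc a b c x y z : jreach (hmk a b c x y z) (hmk b c a y z x).
Proof.
by exists (@hcyc C), (@hcyc C); split; [exact: jauto_hcyc | rewrite hcyc_hmk].
Qed.

Lemma jreach_cyc2 a b c x y z : jreach (hmk a b c x y z) (hmk c a b z x y).
Proof. by apply: jreach_trans (jreach_cyc _ _ _ _ _ _) (jreach_cyc _ _ _ _ _ _). Qed.

Lemma jreach12 u a b c x y z : jreach (hmk a b c x y z)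
  (hmk (a + cform z u + b * cnorm u) b c x (y + cpara u x) (z + b *: u)).
Proof.
exists (hadd12 u), (hadd21 (- u)); split; first exact: jauto_hadd.
exact: hadd12_hmk.
Qed.

Lemma jreach21 u a b c x y z : jreach (hmk a b c x y z)
  (hmk a (b + cform z u + a * cnorm u) c (x + cpara y u) y (z + a *: u)).
Proof.
exists (hadd21 u), (hadd12 (- u)); split; last exact: hadd21_hmk.
by apply: jauto_sym; rewrite -{2}[u]opprK; exact: jauto_hadd.
Qed.

Lemma jreach31 u a b c x y z : jreach (hmk a b c x y z)
  (hmk a b (c + cform y u + a * cnorm u) (x + cpara u z) (y + a *: u) z).
Proof.
apply: jreach_trans (jreach_cyc2 _ _ _ _ _ _) _.
exact: jreach_trans (jreach12 u _ _ _ _ _ _) (jreach_cyc _ _ _ _ _ _).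
Qed.

Lemma jreach13 u a b c x y z : jreach (hmk a b c x y z)
  (hmk (a + cform y u + c * cnorm u) b c x (y + c *: u) (z + cpara x u)).
Proof.
apply: jreach_trans (jreach_cyc2 _ _ _ _ _ _) _.
exact: jreach_trans (jreach21 u _ _ _ _ _ _) (jreach_cyc _ _ _ _ _ _).
Qed.

Lemma jreach23 u a b c x y z : jreach (hmk a b c x y z)
  (hmk a (b + cform x u + c * cnorm u) c (x + c *: u) y (z + cpara u y)).
Proof.
apply: jreach_trans (jreach_cyc _ _ _ _ _ _) _.
exact: jreach_trans (jreach12 u _ _ _ _ _ _) (jreach_cyc2 _ _ _ _ _ _).
Qed.

Lemma jreach32 u a b c x y z : jreach (hmk a b c x y z)
  (hmk a b (c + cform x u + b * cnorm u) (x + b *: u) (y + cpara z u) z).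
Proof.
apply: jreach_trans (jreach_cyc _ _ _ _ _ _) _.
exact: jreach_trans (jreach21 u _ _ _ _ _ _) (jreach_cyc2 _ _ _ _ _ _).
Qed.

(** The effect on a diagonal entry of two consecutive elementary moves, in the form
    to which [min_dvd] applies. *)
Lemma cform_move z a (k t : int) j :
  a + cform (z + a *: (k *: delta_mx 0 j)) (t *: cdual int j)
    = a + t * (z 0 j + k * a).
Proof.
by rewrite cformZr cform_cdual !mxE !eqxx mulr1 (mulrC a).
Qed.

Lemma cnormZ_cdual (t : int) (j : 'I_(cdim C)) : cnorm (t *: cdual int j) = 0.
Proof. by rewrite cnormZ cnorm_cdual mulr0. Qed.

(** With y = z = 0 the moves between the last two indices fix [a] and keep y and z
    zero; the descent is on the second diagonal entry. *)
Lemma diagonalize2 a b c x :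
  exists b' c', jreach (hmk a b c x 0 0) (hmk a b' c' 0 0 0).
Proof.
have [->|/rowV_neq0[j xj]] := eqVneq x 0.
  by exists b, c; exact: jreach_refl.
pose P (t : int * int * V) := jreach (hmk a b c x 0 0) (hmk a t.1.1 t.1.2 t.2 0 0).
have [|[[b' c'] x'] [/= ry b0 min_b]] := @min_abs _ P (fun t => t.1.1).
  have [b0|b0] := eqVneq b 0; last by exists (b, c, x); split; [exact: jreach_refl|].
  have := jreach23 (cdual int j) a b c x 0 0.
  rewrite b0 cform_cdual cnorm_cdual !lin0 => r.
  by exists (x 0 j, c, x + c *: cdual int j); split; rewrite /= /P ?b0.
rewrite /P /= in ry.
have /dvdvP[m xE] : dvdv b' x'.
  move=> i; apply: min_dvd => // k t.
  have r1 := jreach_trans ry (jreach32 (k *: delta_mx 0 i) _ _ _ _ _ _).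
  have := jreach_trans r1 (jreach23 (t *: cdual int i) _ _ _ _ _ _).
  rewrite cnormZ_cdual cform_move !lin0 => r2.
  exact: (min_b (_, _, _) r2).
have := jreach_trans ry (jreach32 (- m) _ _ _ _ _ _).
rewrite {2}xE scalerN subrr !lin0 => r.
by do 2!eexists; exact: r.
Qed.

Lemma jreach_neq0 A : A != 0 -> exists B, jreach A B /\ hdiag B 0 0 != 0.
Proof.
have z_neq0 b c x y z : z != 0 ->
    exists B, jreach (hmk 0 b c x y z) B /\ hdiag B 0 0 != 0.
  move=> /rowV_neq0[j zj]; have := jreach12 (cdual int j) 0 b c x y z.
  by rewrite cform_cdual cnorm_cdual !lin0; eexists; split;
    [eassumption | rewrite hdiag_hmk row3E].
elim/hmk_ind: A => a b c x y z A0.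
have [a0|a0] := eqVneq a 0; last first.
  by exists (hmk a b c x y z); split; [exact: jreach_refl | rewrite hdiag_hmk row3E].
have [b0|b0] := eqVneq b 0; last first.
  by exists (hmk b c a y z x); split; [exact: jreach_cyc | rewrite hdiag_hmk row3E].
have [c0|c0] := eqVneq c 0; last first.
  by exists (hmk c a b z x y); split; [exact: jreach_cyc2 | rewrite hdiag_hmk row3E].
rewrite {}a0 {}b0 {}c0 in A0 *.
have [z0|/z_neq0] := eqVneq z 0; last exact.
have [y0|/(z_neq0 0 0 z x)[B [rB B0]]] := eqVneq y 0; last first.
  by exists B; split=> //; apply: jreach_trans (jreach_cyc2 _ _ _ _ _ _) rB.
have [x0|/(z_neq0 0 0 y z)[B [rB B0]]] := eqVneq x 0; last first.
  by exists B; split=> //; apply: jreach_trans (jreach_cyc _ _ _ _ _ _) rB.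
by rewrite x0 y0 z0 hmk0 eqxx in A0.
Qed.

(** A first diagonal entry [a] of minimal absolute value divides [z] and [y], which
    are cleared by moves that fix [a]. *)
Lemma diagonalize A : exists a b c, jreach A (hmk a b c 0 0 0).
Proof.
have [->|A0] := eqVneq A 0.
  by exists 0, 0, 0; rewrite hmk0; exact: jreach_refl.
have [B [rB B0 min_B]] :=
  @min_abs _ (jreach A) (fun B => hdiag B 0 0) (jreach_neq0 A0).
elim/hmk_ind: B rB B0 min_B => a b c x y z rB; rewrite hdiag_hmk row3E => a0 min_a.
have /dvdvP[m zE] : dvdv a z.
  move=> j; apply: min_dvd => // k t.
  have r1 := jreach_trans rB (jreach21 (k *: delta_mx 0 j) _ _ _ _ _ _).
  have := jreach_trans r1 (jreach12 (t *: cdual int j) _ _ _ _ _ _).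
  by rewrite cnormZ_cdual cform_move mulr0 addr0 => /min_a; rewrite hdiag_hmk row3E.
have /dvdvP[m' yE] : dvdv a y.
  move=> j; apply: min_dvd => // k t.
  have r1 := jreach_trans rB (jreach31 (k *: delta_mx 0 j) _ _ _ _ _ _).
  have := jreach_trans r1 (jreach13 (t *: cdual int j) _ _ _ _ _ _).
  by rewrite cnormZ_cdual cform_move mulr0 addr0 => /min_a; rewrite hdiag_hmk row3E.
have := jreach_trans rB (jreach21 (- m) _ _ _ _ _ _).
rewrite {2}zE scalerN subrr => r1.
have := jreach_trans r1 (jreach31 (- m') _ _ _ _ _ _).
rewrite {3}yE scalerN subrr; move: (_ + _ + _) (_ + _ + _) (_ + _).
move=> x1 c1 b1 r2; have [b' [c' r3]] := diagonalize2 a b1 c1 x1.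
by exists a, b', c'; exact: jreach_trans r2 r3.
Qed.

Lemma reach_diag (x : 'rV[int]_(mdim (Herm C))) : x != 0 ->
  exists (al be : int) (a : 'rV[int]_3), [/\ reach x (melt al be (herm_diag C a) 0),
    0 < al, (al %| be)%Z & forall i, (al %| a 0%R i)%Z].
Proof.
move=> /reach_no_B[al [be [A [rx al0 db /dvdvP[m AE]]]]].
have [a [b [c [f [f' [ff' fA]]]]]] := diagonalize A.
exists al, be, (row3 a b c); split=> //.
  have := reach_trans rx (reach_map _ (inv_map_jlift ff')).
  rewrite /jlift !meltE fA; have [-> _ _ _] := linear_ops (jauto_linr ff').
  by rewrite /hmk !row_mx0.
have [_ _ _ fZ] := linear_ops (jauto_linl ff').
have : dvdv al (hmk a b c 0 0 0 : 'rV_(jdim (Herm C))).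
  by apply/dvdvP; exists (f m); rewrite -fA AE fZ.
move=> /dvdv_hmk[[da dbb dc] _] i.
by rewrite mxE; case: i => [[|[|[|]]]].
Qed.

End Diagonal.

(** * Projective elements and divisors of the gradient *)

Section Projective.

(** Only the quartic form at integral points is known to be preserved; this is
    enough, as polarization evaluates it at sums of [x] and [w]. *)
Lemma qdiff_in_Inv (J : jordan) g (x w : 'rV[int]_(mdim J)) :
  in_Inv g -> qdiff (x *m g) (w *m g) = qdiff x w.
Proof.
move=> [_ gq _]; apply: (@intr_inj rat); apply: oppr_inj.
rewrite -!qdiff_map -!quartic4E ?rat_unit //.
rewrite /quartic4 /polar /= !add0r -!map_mxD -!mulmxDl.
by rewrite !gq.
Qed.

Lemma dvd_qdiff_reach (J : jordan) (d : int) (x y : 'rV[int]_(mdim J)) :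
  reach x y ->
  (forall w, (d %| qdiff x w)%Z) <-> (forall w, (d %| qdiff y w)%Z).
Proof.
move=> [g [gI <-]]; split=> h w; last by rewrite -(qdiff_in_Inv _ _ gI).
have [gu _ _] := gI.
by rewrite -(mulmxKV gu w) qdiff_in_Inv.
Qed.

(** At a diagonal element with B = 0 the off-diagonal directions contribute
    nothing, since they enter the norm and the trace form quadratically. *)
Lemma qdiff_diag (C : composition) (al be : int) (a : 'rV[int]_3) (d : int) :
  (forall w, (d %| qdiff (melt al be (herm_diag C a) 0) w)%Z) <->
  (forall w, (d %| qdiff (melt al be (a : 'rV_(jdim Defs.Split)) 0) w)%Z).
Proof.
have key al' be' a' b' c' a'' b'' c'' (x y z x' y' z' : 'rV[int]_(cdim C)) :
    qdiff (melt al be (herm_diag C a) 0)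
      (melt al' be' (hmk a' b' c' x y z) (hmk a'' b'' c'' x' y' z'))
    = qdiff (melt al be (a : 'rV_(jdim Defs.Split)) 0)
      (melt (J := Defs.Split) al' be' (row3 a' b' c') (row3 a'' b'' c'')).
  rewrite /qdiff !meltE !jsharp0 !jnorm0 !jtr0r !jtr0l !jcross0l !jtr0r.
  elim/row3_ind: a => a b c.
  have -> : herm_diag C (row3 a b c) = hmk a b c 0 0 0.
    by rewrite /herm_diag /hmk !row_mx0.
  rewrite /= jsharp_hmk hnorm_hmk !htr_hmk /jsharp !sum_ord3 !row3E.
  rewrite !(cform0l, cform0r, cpara0l, cnorm0, scaler0, subr0, mulr0, addr0).
  by [].
split=> h; elim/melt_ind => al' be' A B.
  elim/row3_ind: A => *; elim/row3_ind: B => *.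
  by rewrite -(key _ _ _ _ _ _ _ _ 0 0 0 0 0 0).
by elim/hmk_ind: A => *; elim/hmk_ind: B => *; rewrite key.
Qed.

Lemma primitive_of_dvd (a b c : int) :
  (forall d : int, (d %| a)%Z -> (d %| b)%Z -> (d %| c)%Z -> (d %| 1)%Z) ->
  primitive_form a b c.
Proof.
rewrite /primitive_form => h; set g := gcdz _ _.
have gg : (g %| gcdz a b)%Z by exact: dvdz_gcdl.
have : (g %| 1)%Z.
  apply: h; last exact: dvdz_gcdr.
    exact: dvdz_trans gg (dvdz_gcdl _ _).
  exact: dvdz_trans gg (dvdz_gcdr _ _).
suff pos (n : nat) : (n %| 1)%Z -> n = 1 :> int by exact: pos.
by rewrite dvdz1 => /eqP /= ->.
Qed.

Lemma split_projective_of_gcd (al be : int) (a b : 'rV[int]_3) :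
    (forall d : int,
       (forall w, (d %| qdiff (melt (J := Defs.Split) al be a b) w)%Z) ->
       (d %| 1)%Z) ->
  split_projective al be a b.
Proof.
move=> h i j k ij ik jk; apply: primitive_of_dvd => d dA dP dC.
by apply: h; exact: split_dvd_qdiff ij ik jk dA dP dC.
Qed.

Lemma vgcd1_dvd1 n (m : 'rV[int]_n) (d : int) :
  vgcd (ratv m) = 1%N -> dvdv d m -> (d %| 1)%Z.
Proof.
move=> m1 dm; have m0 : m != 0.
  by apply: contra_eq_neq m1 => ->; rewrite vgcd0.
have abs_dm : dvdv `|d|%N m by move=> j; have := dm j; rewrite !dvdzE.
have := vgcd_ge m0 abs_dm; rewrite m1 dvdz1 lez_nat.
case: (posnP `|d|%N) => [d0|]; last by case: (`|d|%N) => [|[|]].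
by move: abs_dm m0; rewrite d0 => /dvdv0 -> /eqP.
Qed.

Lemma projective_dvd2 (J : jordan) (x : 'rV[int]_(mdim J)) (d : int) :
  projective x -> (forall w, (d %| qdiff x w)%Z) -> (d %| 2)%Z.
Proof.
case: J x => [|C] x /=.
  elim/melt_ind: x => al be a b; rewrite !meltE.
  exact: split_projective_dvd2.
move=> [g [al [be [a [gI gx _ pr]]]]] dx.
have rx : reach x (melt al be (herm_diag C a) 0) by exists g.
apply: (split_projective_dvd2 pr); apply/(qdiff_diag C).
exact: (proj1 (dvd_qdiff_reach d rx) dx).
Qed.

Lemma projective_of_dvd1 (J : jordan) (x : 'rV[int]_(mdim J)) :
    (forall d : int, (forall w, (d %| qdiff x w)%Z) -> (d %| 1)%Z) ->
  projective x.
Proof.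
case: J x => [|C] x h /=.
  by elim/melt_ind: x h => al be a b h; rewrite !meltE; exact: split_projective_of_gcd.
have x0 : x != 0.
  apply/eqP => x0; suff: (0 %| 1)%Z by [].
  apply: h => w; have -> : x = melt 0 0 0 0.
    by rewrite x0 /melt !raddf0 !row_mx0.
  rewrite /qdiff !meltE !(jsharp0, jnorm0, jtr0r, jtr0l).
  by rewrite !(mul0r, mulr0, subr0, addr0).
have [al [be [a [rx al0 db da]]]] := reach_diag x0.
have [g [gI gx]] := rx; exists g, al, be, a; split=> //.
apply: split_projective_of_gcd => d /(proj2 (qdiff_diag C al be a d)) dy.
exact: h (proj2 (dvd_qdiff_reach d rx) dy).
Qed.

End Projective.

Theorem corollary44 (J : jordan) (x : 'rV[int]_(mdim J)) :
  [/\ vgcd (Tcube (ratv x)) = vgcd (2^-1 *: grad (ratv x)),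
      vgcd (2^-1 *: grad (ratv x)) = 1%N -> projective x
    & (3 <= vgcd (2^-1 *: grad (ratv x)))%N \/ grad (ratv x) = 0 ->
        ~ projective x].
Proof.
split; first exact: vgcd_Tcube; rewrite half_grad.
  by move=> g1; apply: projective_of_dvd1 => d /dvd_qgrad; exact: vgcd1_dvd1.
move=> big pr; have := projective_dvd2 pr.
case: big => [g3 | grad0].
  move=> /(_ (vgcd (ratv (qgrad x))))/(_ (proj1 (dvd_qgrad _ _) (vgcd_dvdv _))).
  by rewrite dvdzE /= => d2; have := dvdn_leq (isT : 0 < 2)%N d2; rewrite leqNgt g3.
have q0 : qgrad x = 0.
  apply/rowP => j; apply: (@intr_inj rat); have /rowP/(_ j) := half_grad x.
  by rewrite grad0 scaler0 mxE [in RHS]mxE mxE => <-; rewrite mxE.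
move=> /(_ 0) h; suff: (0 %| 2)%Z by [].
by apply/h/dvd_qgrad; rewrite q0; apply/dvdv0.
Qed.
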